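(* Let $\mathcal S=[s_{ij}]$ be a scheme, i.e. the scheme of some canonical marked block matrix, with its partition into zones and their depths. The canonical matrices $A=[a_{ij}]$ with scheme $\mathcal S$ are constructed by successively filling the zones of $\mathcal S$ by numbers, starting with the zones of greatest depth, as follows. Let $Z$ be a zone of depth $d(Z)$ and let all entries in zones of depth $>d(Z)$ be already replaced by numbers. Then all points, circles, and stars of $Z$ are replaced, respectively, by zeros, positive real numbers, and complex numbers such that the following conditions hold: 1) Let $s_{ij}$ and $s_{i+1,j+1}$ be circles in $Z$. Then $a_{ij}=a_{i+1,j+1}$ if $s_{ij}$ and $s_{i+1,j+1}$ are linked by a line, and $a_{ij}>a_{i+1,j+1}$ otherwise. 2) Let $s_{\alpha,\beta},\dots,s_{\alpha+k,\beta+k}$ be all the stars of $Z$ that lie under a certain stair of $Z$. Then $a_{\alpha,\beta}=\dots=a_{\alpha+k,\beta+k}$. If $s_{\alpha+k+1,\beta+k+1},\dots,s_{\alpha+t,\beta+t}$ are all the stars of $Z$ that lie under the next stair of $Z$, then $a_{\alpha,\beta}\succeq a_{\alpha+t,\beta+t}$; moreover, $a_{\alpha,\beta}\succ a_{\alpha+t,\beta+t}$ whenever the columns of the block $[a_{ij}\mid \alpha\le i\le\alpha+k,\ \beta+k+1\le j\le\beta+t]$ are linearly dependent (all entries of this block are located in zones of depth $>d(Z)$, so it has already been filled by numbers).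
   Context: **Orders.** Complex numbers are ordered lexicographically: $a+bi\preceq a'+b'i$ iff $a<a'$, or $a=a'$ and $b\le b'$. The blocks of a block matrix $A=[A_{ij}]$ are ordered by $A_{ij}\le A_{i'j'}$ iff $i>i'$, or $i=i'$ and $j\le j'$ (lower strips first, left to right in a strip). **Marked block matrices.** A marked block matrix is a block complex matrix $A=[A_{ij}]$, $1\le i\le l$, $1\le j\le r$, with a given (perhaps empty) set of marked square blocks. Its admissible transformations are $A\mapsto R^{-1}AS=[R_i^{-1}A_{ij}S_j]$, where $R=R_1\oplus\dots\oplus R_l$, $S=S_1\oplus\dots\oplus S_r$ are unitary and $R_i=S_j$ whenever $A_{ij}$ is marked. Two marked block matrices with the same disposition of marked blocks are equivalent, $A\sim B$, if one is obtained from the other by an admissible transformation. Empty strips are allowed. **Normal forms of one block.** Every complex matrix is unitarily equivalent to a unique matrix $$(1)\quad D=a_1I\oplus\dots\oplus a_{k-1}I\oplus0,\qquad a_1>\dots>a_{k-1}>0$$ (the last block may be non-square or empty). Every square complex matrix is unitarily similar to a block upper triangular matrix $$(2)\quad F=[F_{ij}]_{i,j=1}^k,\ F_{ij}=0\ (i>j),\ F_{ii}=\lambda_iI,\ \lambda_1\succeq\dots\succeq\lambda_k,$$ where the columns of $F_{i,i+1}$ are linearly independent if $\lambda_i=\lambda_{i+1}$; the blocks $F_{ij}$, $i\ge j$, with their sizes are uniquely determined. The canonical part of $D$ is $D$; the canonical part of $F$ is the collection of blocks $F_{ij}$, $i\ge j$. **Derived and canonical matrices.** Let $A_{pq}$ be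 the first block of $A$ that is changed by some admissible transformation. If the marking forces $R_p=S_q$, it is transformed by unitary similarity; otherwise by unitary equivalence. Replace $A$ by an equivalent $\tilde A$ with $\tilde A_{pq}$ of the form (2), respectively (1). The division of $\tilde A_{pq}$ into $k$ horizontal and $k$ vertical strips is extended to the whole $p$th horizontal and whole $q$th vertical strip of $\tilde A$. If new divisions pass through a marked block, perpendicular divisions are made so that this block is partitioned into $k\times k$ subblocks with square diagonal subblocks, which become marked; this is repeated for all new divisions. In case (1) the subblocks $a_1I,\dots,a_{k-1}I$ of $\tilde A_{pq}$ are additionally marked. The result is the derived matrix $A'$; its admissible transformations are exactly those admissible transformations with $\tilde A$ that preserve the canonical part of $\tilde A_{pq}$. Iterating gives $A^{(0)}=A,A^{(1)}=A',\dots,A^{(s)}$, ending when no block is changed by admissible transformations. Removing from $A^{(s)}$ all the additional divisions and marks yields the canonical form $A^\infty$ of $A$; it is uniquely determined, and $A\sim B$ iff $A^\infty=B^\infty$. $A$ is a canonical matrix if $A=A^\infty$; then all $A^{(l)}$ differ from $A$ only by additional divisions and marks. **Zones.** Let $A=A^\infty$, and let $P_l$ ($0\le l<s$) be the first block of $A^{(l)}$ that changes under admissible transformations. Let $A^{(l)}_{ij}$ be a block with $A^{(l)}_{ij}\le P_l$ or $l=s$. Admissible transformations of $A^{(l)}$ induce unitary equivalence or similarity transformations of this block, and it has the form (1), respectively (2); denote its canonical part by $Z(A^{(l)}_{ij})$. By induction on $l$, $Z(A^{(l)}_{ij})$ is called a zone of depth $l$ if $l=0$ or it is not contained in a zone of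 depth $<l$; it is an equivalence zone, respectively a similarity zone. $A$ is partitioned into zones. A similarity zone consisting of the blocks $F_{ij}$, $i\ge j$, of (2) has a staircase-shaped upper-right boundary with $k$ stairs; the entries under its $\nu$th stair on the diagonal are the diagonal entries of $\lambda_\nu I$. **Scheme.** The scheme $\mathcal S(A)$ of a canonical matrix $A$ is obtained from $A$, partitioned into zones, by replacing all diagonal elements of each similarity zone by stars; replacing all nonzero elements of each equivalence zone by circles, and joining with a line the circles of that zone corresponding to equal elements; and replacing the remaining elements (which are zeros) by points. *)

(* Defs.v *)
From HB Require Import structures.
From mathcomp Require Import all_boot all_order all_algebra.
From mathcomp Require Import reals complex.

Set Implicit Arguments.
Unset Strict Implicit.
Unset Printing Implicit Defensive.

Import Order.TTheory GRing.Theory Num.Theory.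
Local Open Scope ring_scope.

Definition clex_le (C : numClosedFieldType) (z w : C) : bool :=
  ('Re z < 'Re w) || (('Re z == 'Re w) && ('Im z <= 'Im w)).

Definition clex_lt (C : numClosedFieldType) (z w : C) : bool :=
  (z != w) && clex_le z w.

(* Entries and windows are indexed by plain numbers, counted from 0; entries   *)
(* outside the matrix are 0.                                                   *)
Definition entry (V : nmodType) m n (A : 'M[V]_(m, n)) (a b : nat) : V :=
  match insub a, insub b with
  | Some i, Some j => A i j
  | _, _ => 0
  end.

Definition window (V : nmodType) m n (A : 'M[V]_(m, n)) (a b h w : nat)
  : 'M[V]_(h, w) := \matrix_(x, y) entry A (a + x) (b + y).

(* The division of m rows into strips is the sequence rs of the heights of the *)
(* strips, with sumn rs = m; heights may be 0. Row a lies in the strip         *)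
(* reshape_index rs a, where it is the row number reshape_offset rs a. The     *)
(* same conventions apply to columns.                                          *)
Definition start (rs : seq nat) (i : nat) : nat := sumn (take i rs).

Definition block (V : nmodType) m n (rs cs : seq nat) (A : 'M[V]_(m, n))
    (i j : nat) : 'M[V]_(nth 0%N rs i, nth 0%N cs j) :=
  window A (start rs i) (start cs j) (nth 0%N rs i) (nth 0%N cs j).

Record marking := Marking {
  rstrips : seq nat;
  cstrips : seq nat;
  marked : rel nat
}.

Definition marking_of (m n : nat) (T : marking) : Prop :=
  [/\ sumn (rstrips T) = m, sumn (cstrips T) = n &
      forall i j, marked T i j ->
        [/\ (i < size (rstrips T))%N, (j < size (cstrips T))%N &
            nth 0%N (rstrips T) i = nth 0%N (cstrips T) j]].

Notation rstrip T := 'I_(size (rstrips T)).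
Notation cstrip T := 'I_(size (cstrips T)).

Definition blk (V : nmodType) m n (T : marking) (A : 'M[V]_(m, n)) i j :=
  block (rstrips T) (cstrips T) A i j.

Definition block_diagonal (V : nmodType) m (rs : seq nat) (R : 'M[V]_m) : Prop :=
  forall i j : 'I_(size rs), i != j -> block rs rs R i j = 0.

Definition diag_block (V : nmodType) m (rs : seq nat) (R : 'M[V]_m) (i h : nat)
  : 'M[V]_h := window R (start rs i) (start rs i) h h.

(* The last condition is R_i = S_j; h is the common size of R_i and S_j.       *)
Definition admissible (C : numClosedFieldType) m n (T : marking)
    (R : 'M[C]_m) (S : 'M[C]_n) : Prop :=
  [/\ R \is unitarymx, S \is unitarymx,
      block_diagonal (rstrips T) R, block_diagonal (cstrips T) S &
      forall (i : rstrip T) (j : cstrip T), marked T i j ->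
        let h := nth 0%N (rstrips T) i in
        diag_block (rstrips T) R i h = diag_block (cstrips T) S j h].

Definition equivalent (C : numClosedFieldType) m n (T : marking)
    (A B : 'M[C]_(m, n)) : Prop :=
  exists R S, admissible T R S /\ B = invmx R *m A *m S.

Definition changes (C : numClosedFieldType) m n (T : marking)
    (A : 'M[C]_(m, n)) (i j : nat) : Prop :=
  exists R S, admissible T R S /\ blk T (invmx R *m A *m S) i j <> blk T A i j.

Definition block_le (u v : nat * nat) : bool :=
  (v.1 < u.1)%N || ((u.1 == v.1) && (u.2 <= v.2)%N).

Definition stable (C : numClosedFieldType) m n (T : marking)
    (A : 'M[C]_(m, n)) : Prop :=
  forall (i : rstrip T) (j : cstrip T), ~ changes T A i j.

Definition first_changed (C : numClosedFieldType) m n (T : marking)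
    (A : 'M[C]_(m, n)) (p : rstrip T) (q : cstrip T) : Prop :=
  changes T A p q /\
  forall (i : rstrip T) (j : cstrip T), changes T A i j ->
    block_le (nat_of_ord p, nat_of_ord q) (nat_of_ord i, nat_of_ord j).

(* tied x y: the summands of R and S belonging to the strips x and y (inl for  *)
(* horizontal, inr for vertical strips) are forced by the marks to be equal.   *)
Definition link_strips T : rel (rstrip T + cstrip T) := fun x y =>
  match x, y with
  | inl i, inr j | inr j, inl i => marked T i j
  | _, _ => false
  end.

Definition tied T : rel (rstrip T + cstrip T) := connect (@link_strips T).

(* D = a_1 I (+) ... (+) a_{k-1} I (+) 0, with ds the sizes of the a_i I.      *)
Definition equivalence_form (C : numClosedFieldType) h w (ds : seq nat)
    (a : seq C) (D : 'M[C]_(h, w)) : Prop :=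
  [/\ size a = size ds, all (ltn 0) ds, (sumn ds <= minn h w)%N,
      sorted >%R (rcons a 0) &
      D = \matrix_(x, y)
        (if x == y :> nat
         then nth 0 (flatten [seq nseq p.1 p.2 | p <- zip ds a]) x else 0)].

(* F is square, but its two dimensions need not be syntactically equal.        *)
Definition similarity_form (C : numClosedFieldType) h w (ds : seq nat)
    (lam : seq C) (F : 'M[C]_(h, w)) : Prop :=
  [/\ size lam = size ds /\ all (ltn 0) ds,
      sumn ds = h /\ sumn ds = w,
      sorted (fun x y => clex_le y x) lam,
      (forall i j : 'I_(size ds), (j < i)%N -> block ds ds F i j = 0) /\
      (forall i : 'I_(size ds), block ds ds F i i = (nth 0 lam i)%:M) &
      forall i, (i.+1 < size ds)%N -> nth 0 lam i = nth 0 lam i.+1 ->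
        row_free (block ds ds F i i.+1)^T].

(* Splitting strip p into dr and strip q into dc. The splitting propagates     *)
(* through the marked blocks, so every strip tied to p (to q) is split alike;  *)
(* when p and q are tied, dr = dc. The marks of the result are the diagonal    *)
(* subblocks of the marked blocks and the first e diagonal subblocks of block  *)
(* (p, q).                                                                     *)
Definition split_strip T (p : rstrip T) (q : cstrip T) (dr dc : seq nat)
    (x : rstrip T + cstrip T) : seq nat :=
  if tied (inl p) x then dr
  else if tied (inr q) x then dc
  else match x with
       | inl i => [:: nth 0%N (rstrips T) i]
       | inr j => [:: nth 0%N (cstrips T) j]
       end.

Definition refine T (p : rstrip T) (q : cstrip T) (dr dc : seq nat) (e : nat)
  : marking :=
  let rss := [seq split_strip p q dr dc (inl i) | i <- enum 'I_(size (rstrips T))] in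
  let css := [seq split_strip p q dr dc (inr j) | j <- enum 'I_(size (cstrips T))] in
  Marking (flatten rss) (flatten css)
    (fun i j =>
       let i0 := reshape_index (shape rss) i in
       let j0 := reshape_index (shape css) j in
       let nu := reshape_offset (shape rss) i in
       (nu == reshape_offset (shape css) j) &&
       (marked T i0 j0 || [&& i0 == p :> nat, j0 == q :> nat & (nu < e)%N])).

Definition derived (C : numClosedFieldType) m n (T : marking) (A : 'M[C]_(m, n))
    (T' : marking) (A' : 'M[C]_(m, n)) : Prop :=
  exists (p : rstrip T) (q : cstrip T),
  [/\ first_changed A p q, equivalent T A A' &
      let h := nth 0%N (rstrips T) p in
      let w := nth 0%N (cstrips T) q in
      if tied (inl p) (inr q) then
        exists ds lam, similarity_form ds lam (blk T A' p q) /\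
          T' = refine p q ds ds 0
      else
        exists ds a, equivalence_form ds a (blk T A' p q) /\
          T' = refine p q (rcons ds (h - sumn ds)%N) (rcons ds (w - sumn ds)%N)
                 (size ds)].

(* A marked block matrix is a pair (T, A); derivation T A s Ts As says that    *)
(* (Ts l, As l), l <= s, is a sequence of successive derived matrices A^(l)    *)
(* ending at s because no block changes any more.                              *)
Definition derivation (C : numClosedFieldType) m n (T : marking)
    (A : 'M[C]_(m, n)) (s : nat) (Ts : nat -> marking)
    (As : nat -> 'M[C]_(m, n)) : Prop :=
  [/\ Ts 0%N = T, As 0%N = A,
      forall l, (l < s)%N -> derived (Ts l) (As l) (Ts l.+1) (As l.+1) &
      stable (Ts s) (As s)].

Definition canonical_form_of (C : numClosedFieldType) m n (T : marking)
    (A B : 'M[C]_(m, n)) : Prop :=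
  exists s Ts As, derivation T A s Ts As /\ As s = B.

Definition canonical (C : numClosedFieldType) m n (T : marking)
    (A : 'M[C]_(m, n)) : Prop := canonical_form_of T A A.

Definition in_block m n T (i : rstrip T) (j : cstrip T) (u : 'I_m * 'I_n) : bool :=
  (reshape_index (rstrips T) u.1 == i) && (reshape_index (cstrips T) u.2 == j).

Definition on_block_diagonal m n T (u : 'I_m * 'I_n) : bool :=
  reshape_offset (rstrips T) u.1 == reshape_offset (cstrips T) u.2.

Definition canonical_part (C : numClosedFieldType) m n (T : marking)
    (A : 'M[C]_(m, n)) (i : rstrip T) (j : cstrip T)
    (Z : {set 'I_m * 'I_n}) : Prop :=
  if tied (inl i) (inr j) then
    exists ds lam, similarity_form ds lam (blk T A i j) /\
      Z = [set u | in_block i j u &&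
            (reshape_index ds (reshape_offset (cstrips T) u.2)
             <= reshape_index ds (reshape_offset (rstrips T) u.1))%N]
  else
    exists ds a, equivalence_form ds a (blk T A i j) /\
      Z = [set u | in_block i j u].

(* Z is the canonical part of a block (i, j) of A^(l) that does not come after *)
(* the first changed block of A^(l) (any block if l = s: none changes).   *)
(* Blocks without entries are left out, so that the zones form a partition.    *)
Definition zone_candidate (C : numClosedFieldType) m n (A : 'M[C]_(m, n))
    (s : nat) (Ts : nat -> marking) (l : nat)
    (i : rstrip (Ts l)) (j : cstrip (Ts l)) (Z : {set 'I_m * 'I_n}) : Prop :=
  [/\ l = s \/ ((l < s)%N /\
        exists (p : rstrip (Ts l)) (q : cstrip (Ts l)), first_changed A p q /\
          block_le (nat_of_ord i, nat_of_ord j) (nat_of_ord p, nat_of_ord q)),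
      canonical_part A i j Z & Z != set0].

Fixpoint zone_below (C : numClosedFieldType) m n (A : 'M[C]_(m, n))
    (s : nat) (Ts : nat -> marking) (d : nat) (Z : {set 'I_m * 'I_n}) : Prop :=
  match d with
  | 0%N => False
  | l.+1 => zone_below A s Ts l Z \/
      ((exists (i : rstrip (Ts l)) (j : cstrip (Ts l)), zone_candidate A s i j Z) /\
       ~ exists2 Z', zone_below A s Ts l Z' & Z \subset Z')
  end.

(* Z is the zone of depth l obtained from the block (i, j) of A^(l).           *)
Definition zone (C : numClosedFieldType) m n (A : 'M[C]_(m, n))
    (s : nat) (Ts : nat -> marking) (l : nat)
    (i : rstrip (Ts l)) (j : cstrip (Ts l)) (Z : {set 'I_m * 'I_n}) : Prop :=
  zone_candidate A s i j Z /\
  ~ exists2 Z', zone_below A s Ts l Z' & Z \subset Z'.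

Inductive symbol := Star | Circle | Point.

(* zones S d is the set of zones of depth d; joined S u v means that circles u *)
(* and v are linked by a line.                                                 *)
Record scheme (m n : nat) := Scheme {
  symb : 'M[symbol]_(m, n);
  zones : nat -> {set {set 'I_m * 'I_n}};
  joined : 'I_m * 'I_n -> 'I_m * 'I_n -> Prop
}.

Definition scheme_of (C : numClosedFieldType) m n (T : marking)
    (A : 'M[C]_(m, n)) (S : scheme m n) : Prop :=
  exists s Ts, derivation T A s Ts (fun=> A) /\
  [/\ forall d Z, Z \in zones S d <->
        exists (i : rstrip (Ts d)) (j : cstrip (Ts d)), zone A s i j Z,
      forall u, symb S u.1 u.2 = Star <->
        exists d (i : rstrip (Ts d)) (j : cstrip (Ts d)) Z,
          [/\ zone A s i j Z, tied (inl i) (inr j), u \in Z &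
              on_block_diagonal (Ts d) u],
      forall u, symb S u.1 u.2 = Circle <->
        exists d (i : rstrip (Ts d)) (j : cstrip (Ts d)) Z,
          [/\ zone A s i j Z, ~~ tied (inl i) (inr j), u \in Z &
              A u.1 u.2 != 0] &
      forall u v, joined S u v <-> u <> v /\
        [/\ symb S u.1 u.2 = Circle, symb S v.1 v.2 = Circle,
            A u.1 u.2 = A v.1 v.2 &
            exists d Z, [/\ Z \in zones S d, u \in Z & v \in Z]]].

(* s_{alpha+x,beta+x}, lo <= x <= hi, are all the stars of Z under one stair.  *)
(* The rows of a similarity zone of the horizontal strip of lambda_nu I reach  *)
(* as far right as that strip does, so the rows under one stair are those that *)
(* meet Z in the same columns.                                                 *)
Definition zone_row m n (Z : {set 'I_m * 'I_n}) (i : 'I_m) : {set 'I_n} :=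
  [set j | (i, j) \in Z].

Definition stars_under_stair m n (S : scheme m n) (Z : {set 'I_m * 'I_n})
    (alpha beta lo hi : nat) : Prop :=
  [/\ (lo <= hi)%N, (alpha + hi < m)%N, (beta + hi < n)%N &
      exists i0 : 'I_m, forall i j,
        [/\ (i, j) \in Z, symb S i j = Star & zone_row Z i = zone_row Z i0] <->
        exists x, [/\ (lo <= x <= hi)%N, i = (alpha + x)%N :> nat &
                      j = (beta + x)%N :> nat]].

Definition admissible_value (C : numClosedFieldType) (c : symbol) (z : C) : Prop :=
  match c with
  | Point => z = 0
  | Circle => 0 < z
  | Star => True
  end.

(* A partially filled scheme is a matrix over option C, None standing for a    *)
(* symbol that has not been replaced yet.                                      *)
Definition zone_filled (C : numClosedFieldType) m n (S : scheme m n)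
    (Z : {set 'I_m * 'I_n}) (Q : 'M[option C]_(m, n)) : Prop :=
  let a := map_mx (odflt 0) Q in
  [/\ forall i j, (i, j) \in Z ->
        exists z, Q i j = Some z /\ admissible_value (symb S i j) z,
      forall (i i' : 'I_m) (j j' : 'I_n),
        i' = i.+1 :> nat -> j' = j.+1 :> nat ->
        (i, j) \in Z -> (i', j') \in Z ->
        symb S i j = Circle -> symb S i' j' = Circle ->
        (joined S (i, j) (i', j') -> a i j = a i' j') /\
        (~ joined S (i, j) (i', j') -> a i' j' < a i j),
      forall alpha beta k, stars_under_stair S Z alpha beta 0 k ->
        forall x, (x <= k)%N ->
          entry a (alpha + x) (beta + x) = entry a alpha beta &
      forall alpha beta k t,
        stars_under_stair S Z alpha beta 0 k ->
        stars_under_stair S Z alpha beta k.+1 t ->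
        let B := window a alpha (beta + k.+1) k.+1 (t - k) in
        clex_le (entry a (alpha + t) (beta + t)) (entry a alpha beta) /\
        (~~ row_free B^T ->
         clex_lt (entry a (alpha + t) (beta + t)) (entry a alpha beta))].

(* filled S d Q: Q results from S by filling successively the zones of depth   *)
(* D, D - 1, ..., d.                                                           *)
Inductive filled (C : numClosedFieldType) m n (S : scheme m n)
  : nat -> 'M[option C]_(m, n) -> Prop :=
| filled_start D :
    (forall d, (D <= d)%N -> zones S d = set0) -> filled S D (const_mx None)
| filled_step d (P Q : 'M[option C]_(m, n)) :
    filled S d.+1 P ->
    (forall i j, (forall Z, Z \in zones S d -> (i, j) \notin Z) ->
       Q i j = P i j) ->
    (forall Z, Z \in zones S d -> zone_filled S Z Q) ->
    filled S d Q.

Definition constructed (C : numClosedFieldType) m n (S : scheme m n)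
    (A : 'M[C]_(m, n)) : Prop := filled S 0 (map_mx Some A).

(* Main.v *)
(* A block (i, j) is changed by no admissible transformation iff it is 0, or
   R_i = S_j is forced and the block is scalar: otherwise a sign change or a
   transposition, performed in all strips tied to one of i, j, moves it. So the
   first changed block P_l depends only on which blocks are fixed in this sense.
   Subblocks of fixed blocks are fixed, and so are the subblocks that the
   refinement at P_l cuts out of the canonical part of P_l. Hence a zone of depth l
   is a union of blocks of every later division, and all those blocks are fixed;
   in particular the zones form a partition, and the part of a similarity block
   above its staircase lies in deeper zones.

   On a zone Z coming from a block of A^(l), the filling conditions say exactly
   that the block of the filled matrix B is in the form (1) or (2) with the same
   sizes as that of A. By induction on l, B then has the same fixed blocks as A at
   each step, so A and B share the whole sequence of divisions, and the scheme. *)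
From mathcomp Require Import boolp zify.
Require Import Defs.
From mathcomp Require Import all_boot all_order all_algebra.
From mathcomp Require Import reals complex.

Set Implicit Arguments.
Unset Strict Implicit.
Unset Printing Implicit Defensive.

Import Order.TTheory GRing.Theory Num.Theory.
Local Open Scope ring_scope.

(** Two quantifications in the definitions have to be made concrete. Whether a block changes refers
    to all admissible unitary pairs, but signed permutations already move every block that is not
    fixed, so change becomes a condition on entries. Being constructed refers to a sequence of
    partial fillings; the conditions on a zone read only that zone and places above its staircase,
    which lie in deeper zones, and zones are disjoint, so all conditions can be tested at once on
    the completed matrix.

    The scheme must also give back the sizes in (1) and (2) from its symbols. In a similarity zone
    the rows of one strip are recognized by meeting the zone in the same columns; in an equivalence
    zone the summands are recognized by the lines between neighbouring circles. For (2) the sizes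
    must moreover be unique, since otherwise the staircase would depend on the form chosen.

    Blocks without entries are a constant side case: they are fixed and give no zone, but they do
    occur in the divisions. *)

Local Notation idx := reshape_index.
Local Notation off := reshape_offset.

(** * Divisions into strips *)

Section Divisions.
Local Open Scope nat_scope.
Implicit Types (ds rs : seq nat) (rss : seq (seq nat)).

Lemma startS ds i : start ds i.+1 = start ds i + nth 0 ds i.
Proof.
rewrite /start; case: (ltnP i (size ds)) => hi.
  by rewrite (take_nth 0 hi) sumn_rcons.
by rewrite nth_default // !take_oversize ?addn0 // leqW.
Qed.

Lemma idx_off ds x : start ds (idx ds x) + off ds x = x.
Proof. exact: reshape_indexK. Qed.

Lemma idx_start ds i x : x < nth 0 ds i -> idx ds (start ds i + x) = i.
Proof. exact: flatten_indexKl. Qed.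

Lemma off_start ds i x : x < nth 0 ds i -> off ds (start ds i + x) = x.
Proof. exact: flatten_indexKr. Qed.

Lemma start_sumn ds i x : x < nth 0 ds i -> start ds i + x < sumn ds.
Proof. exact: flatten_indexP. Qed.

Lemma start_nth_le ds i : start ds i + nth 0 ds i <= sumn ds.
Proof. by rewrite -startS /start -{2}(cat_take_drop i.+1 ds) sumn_cat leq_addr. Qed.

Lemma leq_start ds i j : i <= j -> start ds i <= start ds j.
Proof.
elim: j => [|j IH]; first by rewrite leqn0 => /eqP->.
by rewrite leq_eqVlt => /orP[/eqP->//|/IH h]; rewrite startS; lia.
Qed.

(** Positivity is essential: an empty strip starts where its successor starts. *)
Lemma start_leq ds i j : all (ltn 0) ds -> i < size ds ->
  start ds i <= start ds j -> i <= j.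
Proof.
move=> pos hi h; case: (leqP i j) => // ji.
have := leq_start ds ji; rewrite startS.
have : 0 < nth 0 ds j by apply: (allP pos); rewrite mem_nth ?(ltn_trans ji).
lia.
Qed.

(** A refinement is stored as the list of lists of pieces. After flattening, piece [v] of strip [i]
    has the number [flatten_index (shape rss) i v]; the end position of the list of pieces is
    allowed for [v]. *)
Lemma start_nested rss i v : i < size rss -> v <= size (nth [::] rss i) ->
  start (flatten rss) (flatten_index (shape rss) i v)
  = start (map sumn rss) i + start (nth [::] rss i) v.
Proof.
rewrite /start /flatten_index.
elim: rss i => //= s rss IH [|i] /= hi hv; first by rewrite add0n take_cat;
  case: ltngtP hv => // -> _; rewrite subnn take0 cats0 take_size.
by rewrite -addnA takeD take_size_cat // drop_size_cat // sumn_cat IH // addnA.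
Qed.

Lemma nth_nested rss i v : v < size (nth [::] rss i) ->
  nth 0 (flatten rss) (flatten_index (shape rss) i v) = nth 0 (nth [::] rss i) v.
Proof.
move=> hv; have hv' : v < nth 0 (shape rss) i.
  case: (ltnP i (size rss)) => hi; first by rewrite (nth_map [::]).
  by move: hv; rewrite nth_default.
by rewrite nth_flatten flatten_indexKl // flatten_indexKr.
Qed.

Lemma idx_nested rss x (rs := map sumn rss) (s := nth [::] rss (idx rs x)) :
  x < sumn rs ->
  idx (flatten rss) x = flatten_index (shape rss) (idx rs x) (idx s (off rs x))
  /\ off (flatten rss) x = off s (off rs x).
Proof.
move=> hx; have hi := reshape_indexP hx; have ho := reshape_offsetP hx.
have hi' : idx rs x < size rss by rewrite /rs size_map in hi *.
have ho' : off rs x < sumn s by rewrite (nth_map [::]) in ho.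
have hv := reshape_indexP ho'; have hw := reshape_offsetP ho'.
(* With [x] written as the start of its piece plus a remainder smaller than the piece, [idx_start]
   and [off_start] read off both values. *)
have E : x = start (flatten rss)
    (flatten_index (shape rss) (idx rs x) (idx s (off rs x))) + off s (off rs x).
  by rewrite start_nested // ?(ltnW hv) // -addnA -/s idx_off idx_off.
have hw' : off s (off rs x) < nth 0 (flatten rss)
   (flatten_index (shape rss) (idx rs x) (idx s (off rs x))) by rewrite nth_nested.
by rewrite {1 4}E idx_start // off_start.
Qed.

Lemma nth_pos ds i : all (ltn 0) ds -> i < size ds -> 0 < nth 0 ds i.
Proof. by move=> /allP h hi; apply: h; rewrite mem_nth. Qed.

End Divisions.

(** * Blocks in the coordinates of the whole matrix *)

Section Blocks.
Variables (V : nmodType) (m n : nat).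
Implicit Types (A : 'M[V]_(m, n)) (T : marking).

Lemma entryE A (i : 'I_m) (j : 'I_n) : entry A i j = A i j.
Proof.
rewrite /entry; do 2 (case: insubP => [? _ /val_inj->|]; last by rewrite ltn_ord).
by [].
Qed.

Lemma in_blockP T (i : rstrip T) (j : cstrip T) (u : 'I_m * 'I_n) :
  reflect (idx (rstrips T) u.1 = i /\ idx (cstrips T) u.2 = j) (in_block i j u).
Proof. by apply: (iffP andP) => -[/eqP ? /eqP ?]. Qed.

Section Marking.
Variables (T : marking) (hT : marking_of m n T).

Lemma row_lt (x : 'I_m) : (x < sumn (rstrips T))%N.
Proof. by case: hT => -> _ _. Qed.

Lemma col_lt (y : 'I_n) : (y < sumn (cstrips T))%N.
Proof. by case: hT => _ -> _. Qed.

Lemma row_at (i : nat) x : (x < nth 0 (rstrips T) i)%N ->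
  exists r : 'I_m, r = (start (rstrips T) i + x)%N :> nat.
Proof.
move=> h; have := start_sumn h; case: hT => -> _ _ hm.
by exists (Ordinal hm).
Qed.

Lemma col_at (j : nat) y : (y < nth 0 (cstrips T) j)%N ->
  exists r : 'I_n, r = (start (cstrips T) j + y)%N :> nat.
Proof.
move=> h; have := start_sumn h; case: hT => _ -> _ hm.
by exists (Ordinal hm).
Qed.

Lemma row_in (u : 'I_m) i : idx (rstrips T) u = i ->
  u = (start (rstrips T) i + off (rstrips T) u)%N :> nat /\
  (off (rstrips T) u < nth 0 (rstrips T) i)%N.
Proof. by move=> <-; rewrite idx_off; split=> //; apply/reshape_offsetP/row_lt. Qed.

Lemma col_in (u : 'I_n) i : idx (cstrips T) u = i ->
  u = (start (cstrips T) i + off (cstrips T) u)%N :> nat /\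
  (off (cstrips T) u < nth 0 (cstrips T) i)%N.
Proof. by move=> <-; rewrite idx_off; split=> //; apply/reshape_offsetP/col_lt. Qed.

Lemma row_inj (x y : 'I_m) : idx (rstrips T) x = idx (rstrips T) y ->
  off (rstrips T) x = off (rstrips T) y -> x = y.
Proof.
move=> h1 h2; apply: val_inj => /=.
by rewrite -(idx_off (rstrips T) x) h1 h2 idx_off.
Qed.

Lemma col_inj (x y : 'I_n) : idx (cstrips T) x = idx (cstrips T) y ->
  off (cstrips T) x = off (cstrips T) y -> x = y.
Proof.
move=> h1 h2; apply: val_inj => /=.
by rewrite -(idx_off (cstrips T) x) h1 h2 idx_off.
Qed.

(** The size of [blk] is part of its type. Letting [P] speak of offsets as plain numbers moves
    statements between such a block and the entries of the whole matrix without casts. *)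
Lemma forall_blk A (i : rstrip T) (j : cstrip T) (P : nat -> nat -> V -> Prop) :
  (forall (x : 'I_(nth 0%N (rstrips T) i)) (y : 'I_(nth 0%N (cstrips T) j)),
     P x y (blk T A i j x y)) <->
  (forall u : 'I_m * 'I_n, in_block i j u ->
     P (off (rstrips T) u.1) (off (cstrips T) u.2) (A u.1 u.2)).
Proof.
split=> h => [[x y] /in_blockP /= [hx hy]|x y].
  have [ex lx] := row_in hx; have [ey ly] := col_in hy.
  have := h (Ordinal lx) (Ordinal ly).
  by rewrite mxE /= -ex -ey entryE.
have [r er] := row_at (ltn_ord x); have [c ec] := col_at (ltn_ord y).
have := h (r, c); rewrite mxE -er -ec entryE /in_block /=.
by rewrite er ec !idx_start ?off_start ?eqxx //; apply.
Qed.

Lemma blk_eqP A B (i : rstrip T) (j : cstrip T) :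
  blk T A i j = blk T B i j <->
  (forall u : 'I_m * 'I_n, in_block i j u -> A u.1 u.2 = B u.1 u.2).
Proof.
split=> [/matrixP h|h].
  have /(forall_blk A i j (fun x y v => v = entry B (start (rstrips T) i + x)
      (start (cstrips T) j + y))) H : forall (x : 'I__) (y : 'I__), blk T A i j x y =
      entry B (start (rstrips T) i + x) (start (cstrips T) j + y).
    by move=> x y; rewrite h mxE.
  move=> u hu; rewrite (H u hu).
  have /in_blockP [/row_in[<- _] /col_in[<- _]] := hu.
  by rewrite entryE.
have /(forall_blk A i j (fun x y v => v = entry B (start (rstrips T) i + x)
      (start (cstrips T) j + y))) H : forall u : 'I_m * 'I_n, in_block i j u ->
   A u.1 u.2 = entry B (start (rstrips T) i + off (rstrips T) u.1)
      (start (cstrips T) j + off (cstrips T) u.2).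
  move=> u hu; rewrite (h u hu).
  have /in_blockP [/row_in[<- _] /col_in[<- _]] := hu.
  by rewrite entryE.
by apply/matrixP => x y; rewrite H mxE.
Qed.

End Marking.
End Blocks.

Definition strip_size T (x : rstrip T + cstrip T) : nat :=
  match x with
  | inl i => nth 0%N (rstrips T) i
  | inr j => nth 0%N (cstrips T) j
  end.

Lemma link_sym T : symmetric (@link_strips T).
Proof. by case=> x [] y. Qed.

Lemma tied_sym T : symmetric (@tied T).
Proof. exact/sym_connect_sym/link_sym. Qed.

Lemma tied_ind T (P : rstrip T + cstrip T -> rstrip T + cstrip T -> Prop) :
  (forall x, P x x) ->
  (forall x y z, link_strips x y -> P y z -> P x z) ->
  forall x y, tied x y -> P x y.
Proof.
move=> h0 h1 x y /connectP[p]; elim: p x => [|z p IH] x /=; first by move=> _ ->.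
by case/andP=> hxz hp hy; apply: (h1 _ z) => //; apply: IH.
Qed.

Lemma tied_size m n T (hT : marking_of m n T) (x y : rstrip T + cstrip T) :
  tied x y -> strip_size x = strip_size y :> nat.
Proof.
case: hT => _ _ hT'; move: x y; apply: tied_ind => // x y z.
by case: x => i; case: y => j //= /hT'[_ _ ->] <-.
Qed.

Lemma block_diagonalP (C : numClosedFieldType) p (rs : seq nat)
    (hrs : sumn rs = p) (R : 'M[C]_p) :
  block_diagonal rs R <->
  forall x y : 'I_p, idx rs x != idx rs y -> R x y = 0.
Proof.
have lt (x : 'I_p) : (x < sumn rs)%N by rewrite hrs.
split=> [h x y xy|h i j ij].
  have /matrixP := h (Ordinal (reshape_indexP (lt x)))
                     (Ordinal (reshape_indexP (lt y))) xy.
  move/(_ (Ordinal (reshape_offsetP (lt x))) (Ordinal (reshape_offsetP (lt y)))).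
  by rewrite !mxE /= !idx_off entryE.
apply/matrixP => a b; rewrite !mxE.
have ha := start_sumn (ltn_ord a); have hb := start_sumn (ltn_ord b).
rewrite hrs in ha hb.
have := h (Ordinal ha) (Ordinal hb); rewrite -entryE /=; apply.
by rewrite !idx_start.
Qed.

(** * Blocks changed by admissible transformations *)

Section SignedInvolution.
Variables (C : numClosedFieldType) (p : nat) (ds : seq nat).
Hypothesis hds : sumn ds = p.
Variables (K : pred nat) (h : nat) (e : pred nat) (g : nat -> nat).
Hypothesis Kh : forall k, K k -> nth 0%N ds k = h.
Hypothesis gK : involutive g.
Hypothesis gh : forall a, (a < h)%N -> (g a < h)%N.

Local Notation gk k a := (if K k then g a else a).

(** The default value of [insubd] never occurs: [g] keeps offsets below the common size [h] of the
    strips in [K]. *)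
Definition flip (x : 'I_p) : 'I_p :=
  insubd x (start ds (idx ds x) + gk (idx ds x) (off ds x))%N.

Let gk_lt k a : (a < nth 0 ds k)%N -> (gk k a < nth 0 ds k)%N.
Proof. by case: ifP => // /Kh ->; apply: gh. Qed.

Let lt (x : 'I_p) : (x < sumn ds)%N. Proof. by rewrite hds. Qed.

Let flipE x : flip x = (start ds (idx ds x) + gk (idx ds x) (off ds x))%N :> nat.
Proof.
rewrite /flip insubdK //; have : (off ds x < nth 0 ds (idx ds x))%N.
  exact: reshape_offsetP.
by move/gk_lt/start_sumn; rewrite hds.
Qed.

Lemma idx_flip x : idx ds (flip x) = idx ds x.
Proof. by rewrite flipE idx_start // gk_lt // reshape_offsetP. Qed.

Lemma off_flip x : off ds (flip x) = gk (idx ds x) (off ds x).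
Proof. by rewrite flipE off_start // gk_lt // reshape_offsetP. Qed.

Lemma flipK : involutive flip.
Proof.
move=> x; apply: val_inj; rewrite /= flipE idx_flip off_flip.
by case: (K _); rewrite ?gK idx_off.
Qed.

Local Notation sgn x := ((-1 : C) ^+ (K (idx ds x) && e (off ds x))).

(** The identity outside the strips in [K]. Two kinds occur later: pure sign changes ([g] the
    identity) and transpositions of two offsets ([e] empty). *)
Definition signed_flip : 'M[C]_p := \matrix_(x, y) (sgn x * (flip x == y)%:R).

Let sgn2 x : sgn x * sgn x = 1.
Proof. by case: (_ && _); rewrite ?expr1 ?expr0 ?mulrNN ?mulr1. Qed.

Let sgnC x : (sgn x)^* = sgn x.
Proof. by rewrite rmorphXn rmorphN1. Qed.

Lemma signed_flip_unitary : signed_flip \is unitarymx.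
Proof.
apply/unitarymxP/matrixP => x y; rewrite !mxE (bigD1 (flip x)) //= big1.
  rewrite !mxE eqxx mulr1 addr0 rmorphM /= sgnC conjC_nat.
  rewrite (inj_eq (can_inj flipK)) eq_sym.
  by case: eqVneq => [->|_]; rewrite ?mulr1 ?sgn2 ?mulr0.
by move=> z hz; rewrite !mxE eq_sym (negPf hz) mulr0 mul0r.
Qed.

Lemma signed_flip_block_diagonal : block_diagonal ds signed_flip.
Proof.
apply/(block_diagonalP hds _) => x y xy; rewrite mxE.
by case: (flip x =P y) xy => [<-|]; rewrite ?idx_flip ?eqxx // mulr0.
Qed.

(** The right-hand side involves the strip only through [K k]. So a row strip and a column strip of
    equal size that are both in their families, or both outside, get equal summands, as
    admissibility demands. *)
Lemma signed_flip_summand k a b : (a < nth 0 ds k)%N -> (b < nth 0 ds k)%N ->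
  entry signed_flip (start ds k + a) (start ds k + b)
  = (-1) ^+ (K k && e a) * (gk k a == b)%:R.
Proof.
move=> ha hb; have la := start_sumn ha; have lb := start_sumn hb.
rewrite hds in la lb.
rewrite -[(_ + a)%N]/(val (Ordinal la)) -[(_ + b)%N]/(val (Ordinal lb)) entryE.
rewrite mxE /= idx_start // off_start //; congr (_ * (nat_of_bool _)%:R).
by rewrite -val_eqE /= flipE /= idx_start // off_start // eqn_add2l.
Qed.

Lemma mul_signed_flip q (A : 'M[C]_(p, q)) x y :
  (invmx signed_flip *m A) x y = sgn (flip x) * A (flip x) y.
Proof.
rewrite invmx_unitary ?signed_flip_unitary // mxE (bigD1 (flip x)) //= big1.
  by rewrite addr0 !mxE flipK eqxx mulr1 sgnC.
move=> z hz; rewrite !mxE; case: eqP => [E|]; last by rewrite mulr0 conjC0 mul0r.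
by move: hz; rewrite -E flipK eqxx.
Qed.

Lemma signed_flip_mul q (A : 'M[C]_(q, p)) x y :
  (A *m signed_flip) x y = A x (flip y) * sgn (flip y).
Proof.
rewrite mxE (bigD1 (flip y)) //= big1.
  by rewrite addr0 !mxE flipK eqxx mulr1.
move=> z hz; rewrite !mxE; case: eqP => [E|]; last by rewrite !mulr0.
by move: hz; rewrite -E flipK eqxx.
Qed.

End SignedInvolution.

(** * The unchanged blocks are the fixed ones *)

Section Changes.
Variables (C : numClosedFieldType) (m n : nat) (T : marking).
Hypothesis hT : marking_of m n T.
Implicit Types (A : 'M[C]_(m, n)) (i : rstrip T) (j : cstrip T).

Definition zero_block A i j :=
  forall u : 'I_m * 'I_n, in_block i j u -> A u.1 u.2 = 0.

Definition scalar_block A i j (z : C) :=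
  forall u : 'I_m * 'I_n, in_block i j u ->
    A u.1 u.2 = if on_block_diagonal T u then z else 0.

Definition fixed_block A i j :=
  zero_block A i j \/ (tied (inl i) (inr j) /\ exists z, scalar_block A i j z).

(** Offsets are plain numbers because the sizes of tied strips are equal by a proof and not by
    conversion. *)
Definition summand (R : 'M[C]_m) (S : 'M[C]_n) (x : rstrip T + cstrip T)
    (a b : nat) : C :=
  match x with
  | inl i => entry R (start (rstrips T) i + a) (start (rstrips T) i + b)
  | inr j => entry S (start (cstrips T) j + a) (start (cstrips T) j + b)
  end.

Lemma tied_summand R S (x y : rstrip T + cstrip T) : admissible T R S ->
  tied x y -> forall a b, (a < strip_size x)%N -> (b < strip_size x)%N ->
  summand R S x a b = summand R S y a b.
Proof.
case=> _ _ _ _ hRS; move: x y; apply: tied_ind => // x y z xy IH a b ha hb.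
have sxy := tied_size hT (connect1 xy).
rewrite -IH -?sxy //; have {}hRS i j : marked T i j ->
  (a < nth 0 (rstrips T) i)%N -> (b < nth 0 (rstrips T) i)%N ->
  summand R S (inl i) a b = summand R S (inr j) a b.
  move=> mij {}ha {}hb; have /matrixP/(_ (Ordinal ha) (Ordinal hb)) := hRS i j mij.
  by rewrite !mxE.
case: x xy ha hb sxy => [i|j]; case: y {IH} => [i'|j'] // xy ha hb sxy.
  exact: hRS.
by move: ha hb; rewrite sxy => ha hb; apply/esym/hRS.
Qed.

(** A zero block, or a scalar block with [R_i = S_j], satisfies [A S = R A] there. Since
    [R^-1 A S = A + R^-1 (A S - R A)] and [R^-1] is block diagonal, the correction vanishes on the
    block. *)
Lemma fixed_unchanged A i j : fixed_block A i j -> ~ changes T A i j.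
Proof.
move=> fA [R [S [RS]]]; apply; apply/(blk_eqP hT) => u hu.
have [uR uS dR dS _] := RS.
have [hm hn _] := hT.
have {}dR := (block_diagonalP hm R).1 dR.
have {}dS := (block_diagonalP hn S).1 dS.
have AS : forall x y, in_block i j (x, y) -> (A *m S) x y = (R *m A) x y.
  move=> x y xy; rewrite !mxE; have /in_blockP [/= hx hy] := xy.
  have off0 (y' : 'I_n) : idx (cstrips T) y' != j -> S y' y = 0.
    by move=> h; apply: dS; rewrite hy.
  have off0' (x' : 'I_m) : idx (rstrips T) x' != i -> R x x' = 0.
    by move=> h; apply: dR; rewrite hx eq_sym.
  case: fA => [A0|[tij [z Az]]].
    rewrite !big1 // => [x' _|y' _].
      case: (eqVneq (idx (rstrips T) x') i) => [h|/off0'->]; last by rewrite mul0r.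
      by rewrite (A0 (x', y)) ?mulr0 // /in_block /= h hy !eqxx.
    case: (eqVneq (idx (cstrips T) y') j) => [h|/off0->]; last by rewrite mulr0.
    by rewrite (A0 (x, y')) ?mul0r // /in_block /= h hx !eqxx.
  have [ex lx] := row_in hT hx; have [ey ly] := col_in hT hy.
  have sz := tied_size hT tij; rewrite /= in sz.
  have ly' := ly; have lx' := lx; rewrite -sz in ly'; rewrite sz in lx'.
  (* Row [x] meets the diagonal of the block in column [y0], and column [y] meets it in row [x0];
     each of the two sums keeps only that term. *)
  have [x0 ex0] := row_at hT ly'; have [y0 ey0] := col_at hT lx'.
  rewrite (bigD1 y0) //= big1 => [|y' ny']; last first.
    case: (eqVneq (idx (cstrips T) y') j) => [h|/off0->]; last by rewrite mulr0.
    rewrite (Az (x, y')) /in_block /on_block_diagonal /= ?hx ?h ?eqxx //.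
    case: eqP => [e|_]; last by rewrite mul0r.
    have [ey' _] := col_in hT h.
    by case/eqP: ny'; apply: val_inj; rewrite /= ey0 ey' e.
  rewrite (bigD1 x0) //= big1 => [|x' nx']; last first.
    case: (eqVneq (idx (rstrips T) x') i) => [h|/off0'->]; last by rewrite mul0r.
    rewrite (Az (x', y)) /in_block /on_block_diagonal /= ?hy ?h ?eqxx //.
    case: eqP => [e|_]; last by rewrite mulr0.
    have [ex' _] := row_in hT h.
    by case/eqP: nx'; apply: val_inj; rewrite /= ex0 ex' e.
  have -> : A x y0 = z.
    rewrite (Az (x, y0)) /in_block /on_block_diagonal /= ?hx ey0 ?idx_start
      ?off_start ?eqxx //.
  have -> : A x0 y = z.
    rewrite (Az (x0, y)) /in_block /on_block_diagonal /= ?hy ex0 ?idx_start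
      ?off_start ?eqxx //.
  rewrite !addr0 mulrC; congr (_ * _).
  rewrite -(entryE S) -(entryE R) ey0 ex0 {1}ey ex.
  by have := tied_summand RS tij lx ly' => /= ->; rewrite off_start.
have uR' := unitarymx_unit uR.
have -> : invmx R *m A *m S = A + invmx R *m (A *m S - R *m A).
  by rewrite mulmxBr !mulmxA mulVmx // mul1mx addrC subrK.
rewrite mxE mxE big1 ?addr0 // => x _.
have /in_blockP [hx hy] := hu.
case: (eqVneq (idx (rstrips T) x) i) => [h|h].
  have xu : in_block i j (x, u.2) by rewrite /in_block /= h hy !eqxx.
  have -> : (A *m S - R *m A) x u.2 = 0.
    by rewrite [LHS]mxE AS // [X in _ + X]mxE subrr.
  by rewrite mulr0.
rewrite invmx_unitary // !mxE (dR x) ?conjC0 ?mul0r //.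
by rewrite hx.
Qed.

(** The signed permutation is applied in all strips tied to the row strip [i], and it carries the
    entry at [v] to [u]. The columns of strip [j] take part exactly when [t] holds, which accounts
    for the two conditionals on [t]. *)
Lemma flip_changes A i j (e : pred nat) (g : nat -> nat) (u v : 'I_m * 'I_n)
    (t := tied (inl i) (inr j)) :
  involutive g ->
  (forall a, (a < nth 0 (rstrips T) i)%N -> (g a < nth 0 (rstrips T) i)%N) ->
  in_block i j u -> in_block i j v ->
  off (rstrips T) v.1 = g (off (rstrips T) u.1) ->
  off (cstrips T) v.2 = (if t then g else id) (off (cstrips T) u.2) ->
  (-1) ^+ e (off (rstrips T) v.1) * A v.1 v.2
    * (-1) ^+ (t && e (off (cstrips T) v.2)) != A u.1 u.2 ->
  changes T A i j.
Proof.
move=> gK gh hu hv ov1 ov2 neq; have [hm hn hmk] := hT.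
pose Kr k := [exists x : rstrip T, (x == k :> nat) && tied (inl i) (inl x)].
pose Kc k := [exists y : cstrip T, (y == k :> nat) && tied (inl i) (inr y)].
have KrE (x : rstrip T) : Kr x = tied (inl i) (inl x).
  apply/existsP/idP => [[x' /andP[/eqP/val_inj->]]//|h].
  by exists x; rewrite eqxx.
have KcE (y : cstrip T) : Kc y = tied (inl i) (inr y).
  apply/existsP/idP => [[x' /andP[/eqP/val_inj->]]//|h].
  by exists y; rewrite eqxx.
have Krh k : Kr k -> nth 0%N (rstrips T) k = nth 0%N (rstrips T) i.
  by case/existsP=> x /andP[/eqP <- /(tied_size hT)/= ->].
have Kch k : Kc k -> nth 0%N (cstrips T) k = nth 0%N (rstrips T) i.
  by case/existsP=> x /andP[/eqP <- /(tied_size hT)/= ->].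
pose R := signed_flip C m (rstrips T) Kr e g.
pose S := signed_flip C n (cstrips T) Kc e g.
exists R, S; split.
  split; [exact: signed_flip_unitary Krh gK gh
    |exact: signed_flip_unitary Kch gK gh
    |exact: signed_flip_block_diagonal Krh gh
    |exact: signed_flip_block_diagonal Kch gh|].
  move=> x y xy /=; have [_ _ sz] := hmk _ _ xy.
  apply/matrixP=> a b; rewrite !mxE.
  rewrite (signed_flip_summand _ hm _ Krh gh) //.
  rewrite (signed_flip_summand _ hn _ Kch gh) -?sz //.
  rewrite KrE KcE; have -> : tied (inl i) (inl x) = tied (inl i) (inr y) => //.
  by apply/idP/idP => /connect_trans; apply; apply: connect1.
move/(blk_eqP hT) => /(_ u hu).
rewrite (signed_flip_mul hn _ Kch gK gh) (mul_signed_flip hm _ Krh gK gh).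
have /in_blockP[iu1 iu2] := hu; have /in_blockP[iv1 iv2] := hv.
have Kri : Kr i by rewrite KrE; apply: connect0.
have -> : flip (rstrips T) Kr g u.1 = v.1.
  by apply: (@row_inj m T);
    rewrite ?(idx_flip hm Krh gh) ?(off_flip hm Krh gh) iu1 ?iv1 // Kri.
have -> : flip (cstrips T) Kc g u.2 = v.2.
  apply: (@col_inj n T);
    rewrite ?(idx_flip hn Kch gh) ?(off_flip hn Kch gh) iu2 ?iv2 //.
  by rewrite KcE ov2 -/t; case: (t).
rewrite iv1 iv2 Kri KcE; exact/eqP.
Qed.

Lemma unchanged_fixed A i j : ~ changes T A i j -> fixed_block A i j.
Proof.
move=> nch; apply: contrapT => nf; apply: nch.
have [u hu nz] : exists2 u : 'I_m * 'I_n, in_block i j u & A u.1 u.2 != 0.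
  apply: contrapT => h; apply: nf; left=> u hu; apply: contrapT => /eqP nz.
  by apply: h; exists u.
have neqN (z : C) : z != 0 -> - z != z.
  by move=> z0; rewrite -subr_eq0 -opprD oppr_eq0 -mulr2n mulrn_eq0.
(* If the strips are not tied, a sign change in all rows of strip [i] leaves the columns alone and
   negates the whole block. *)
have [t|nt] := boolP (tied (inl i) (inr j)); last first.
  apply: (@flip_changes A i j predT id u u) => //=; first by case: ifP.
  by rewrite (negPf nt) expr1 expr0 mulr1 mulN1r neqN.
have sz := tied_size hT t; rewrite /= in sz.
(* For tied strips, a sign change at the single offset of the row of [v] acts on [v] from the left
   only, because its column has another offset. *)
have [[v hv /andP[ov nv]]|all0] := pselect (exists2 v : 'I_m * 'I_n,
    in_block i j v & ~~ on_block_diagonal T v && (A v.1 v.2 != 0)).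
  apply: (@flip_changes A i j (pred1 (off (rstrips T) v.1)) id v v) => //=.
    by case: ifP.
  rewrite t eqxx /= [off (cstrips T) v.2 == _]eq_sym.
  by rewrite /on_block_diagonal in ov; rewrite (negPf ov) expr0 mulr1 mulN1r neqN.
have od v : in_block i j v -> ~~ on_block_diagonal T v -> A v.1 v.2 = 0.
  by move=> hv ov; apply: contrapT => /eqP nv; apply: all0; exists v; rewrite ?ov.
have ou : on_block_diagonal T u.
  by apply: contraT => /(od _ hu)/eqP; rewrite (negPf nz).
(* What remains is a diagonal block that is not scalar; exchanging the offsets of two different
   diagonal entries moves it. *)
have [v hv [ov nv]] : exists2 v, in_block i j v &
    on_block_diagonal T v /\ A v.1 v.2 != A u.1 u.2.
  apply: contrapT => h; apply: nf; right; split=> //; exists (A u.1 u.2) => v hv.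
  case: ifPn => [ov|]; last exact: od.
  by apply: contrapT => /eqP nv; apply: h; exists v.
set a := off (rstrips T) u.1; set b := off (rstrips T) v.1.
have /in_blockP[/(row_in hT)[_ la] _] := hu.
have /in_blockP[/(row_in hT)[_ lb] _] := hv.
pose g o := if o == a then b else if o == b then a else o.
apply: (@flip_changes A i j pred0 g u v) => //=.
- move=> o; rewrite /g; case: (eqVneq o a) => [->|na].
    by case: (eqVneq b a) => [->|_] //; rewrite eqxx.
  by case: (eqVneq o b) => [->|nb]; rewrite ?eqxx // (negPf na) (negPf nb).
- by move=> o ho; rewrite /g; do 2 case: ifP => // _.
- by rewrite /g eqxx.
- by rewrite t -(eqP ov) -(eqP ou) /g eqxx.
- by rewrite t expr0 mul1r mulr1.
Qed.

Lemma changesP A i j : changes T A i j <-> ~ fixed_block A i j.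
Proof.
split=> [ch /fixed_unchanged|nf]; first by apply.
by apply: contrapT => /unchanged_fixed.
Qed.

End Changes.

(** * Refinement of a marking *)

Section Rcons.
Local Open Scope nat_scope.

Lemma start_rcons ds a i : i <= size ds -> start (rcons ds a) i = start ds i.
Proof.
by move=> hi; rewrite /start -cats1 take_cat; case: ltngtP hi => // -> _;
  rewrite subnn take0 cats0 take_size.
Qed.

Lemma idx_rcons ds a x : x < sumn ds ->
  idx (rcons ds a) x = idx ds x /\ off (rcons ds a) x = off ds x.
Proof.
move=> hx; have hi := reshape_indexP hx; have ho := reshape_offsetP hx.
have ho' : off ds x < nth 0 (rcons ds a) (idx ds x) by rewrite nth_rcons hi.
have E := idx_off ds x; rewrite -(start_rcons a (ltnW hi)) in E.
by rewrite -{1 3}E idx_start ?off_start.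
Qed.

Lemma idx_rcons_last ds a x : sumn ds <= x -> x < sumn ds + a ->
  idx (rcons ds a) x = size ds.
Proof.
move=> h1 h2; rewrite -{1}(subnKC h1) -[in X in (X + _)](take_size ds).
rewrite -/(start ds (size ds)) -(start_rcons a (leqnn _)) idx_start //.
by rewrite nth_rcons ltnn eqxx; lia.
Qed.

(** The lookup returns an invalid strip number out of range. Conversely, a valid result bounds the
    argument, which is how the marks of a refinement are shown to lie in range. *)
Lemma idx_out ds x : sumn ds <= x -> idx ds x = size ds.
Proof.
rewrite /reshape_index; elim: ds x => //= a ds IH x; rewrite subn_eq0 => h.
by rewrite ltnNge (leq_trans (leq_addr _ _) h) /= subSn ?IH //; lia.
Qed.

End Rcons.

Section Refine.
Variables (m n : nat) (T : marking).
Hypothesis hT : marking_of m n T.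
Variables (p : rstrip T) (q : cstrip T) (dr dc : seq nat) (e : nat).
Hypotheses (hdr : sumn dr = nth 0%N (rstrips T) p)
  (hdc : sumn dc = nth 0%N (cstrips T) q)
  (htie : tied (inl p) (inr q) -> dr = dc)
  (he : forall v, (v < e)%N ->
     [/\ (v < size dr)%N, (v < size dc)%N & nth 0%N dr v = nth 0%N dc v]).

Local Notation T' := (refine p q dr dc e).
Local Notation split := (split_strip p q dr dc).

Let rss := [seq split (inl i) | i <- enum 'I_(size (rstrips T))].
Let css := [seq split (inr j) | j <- enum 'I_(size (cstrips T))].

Lemma split_tied x y : tied x y -> split x = split y.
Proof.
move=> xy; rewrite /split_strip.
have E z : tied z x = tied z y.
  by apply/idP/idP => h; apply: (connect_trans h) => //; rewrite -/(tied y x) tied_sym.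
rewrite !E; case: ifPn => // n1; case: ifPn => // n2.
move: (tied_size hT xy).
by case: x y {xy E} n1 n2 => [i|j] [i'|j'] /= _ _ ->.
Qed.

Lemma split_row : split (inl p) = dr.
Proof. by rewrite /split_strip /tied connect0. Qed.

(** [split_strip] tests [p] first, so for tied [p] and [q] the value is [dr], and the equality of
    [dr] and [dc] enters. *)
Lemma split_col : split (inr q) = dc.
Proof.
by rewrite /split_strip; case: ifP => [/htie|_] //; rewrite /tied connect0.
Qed.

Lemma sumn_split x : sumn (split x) = strip_size x.
Proof.
have [hx|hx] := boolP (tied (inl p) x).
  by rewrite -(split_tied hx) split_row hdr -(tied_size hT hx).
have [hx'|hx'] := boolP (tied (inr q) x).
  by rewrite -(split_tied hx') split_col hdc -(tied_size hT hx').
rewrite /split_strip (negPf hx) (negPf hx').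
by case: x {hx hx'} => i /=; rewrite addn0.
Qed.

Let nth_rss (i : rstrip T) : nth [::] rss i = split (inl i).
Proof.
by rewrite (nth_map i) ?size_enum_ord // nth_ord_enum.
Qed.

Let nth_css (j : cstrip T) : nth [::] css j = split (inr j).
Proof.
by rewrite (nth_map j) ?size_enum_ord // nth_ord_enum.
Qed.

Let size_rss : size rss = size (rstrips T).
Proof. by rewrite size_map size_enum_ord. Qed.

Let size_css : size css = size (cstrips T).
Proof. by rewrite size_map size_enum_ord. Qed.

Let sumn_rss : map sumn rss = rstrips T.
Proof.
apply: (@eq_from_nth _ 0%N); rewrite size_map ?size_rss // => k hk.
by rewrite (nth_map [::]) ?size_rss // (nth_rss (Ordinal hk)) sumn_split.
Qed.

Let sumn_css : map sumn css = cstrips T.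
Proof.
apply: (@eq_from_nth _ 0%N); rewrite size_map ?size_css // => k hk.
by rewrite (nth_map [::]) ?size_css // (nth_css (Ordinal hk)) sumn_split.
Qed.

(* x' is the v-th piece of the strip x. *)
Definition child (x : rstrip T + cstrip T) v (x' : rstrip T' + cstrip T') : Prop :=
  match x, x' with
  | inl i, inl i' => i' = flatten_index (shape rss) i v :> nat
  | inr j, inr j' => j' = flatten_index (shape css) j v :> nat
  | _, _ => False
  end.

Lemma child_inj x v x' x'' : child x v x' -> child x v x'' -> x' = x''.
Proof.
by case: x x' x'' => [i|j] [i'|j'] [i''|j''] //= h1 h2; congr (_ _);
  apply: val_inj; rewrite /= h1 h2.
Qed.

Let shape_r i v : (v < size (split (inl i)))%N = (v < nth 0%N (shape rss) i)%N.
Proof. by rewrite (nth_map [::]) ?size_rss // nth_rss. Qed.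

Let shape_c j v : (v < size (split (inr j)))%N = (v < nth 0%N (shape css) j)%N.
Proof. by rewrite (nth_map [::]) ?size_css // nth_css. Qed.

Lemma child_ex x v : (v < size (split x))%N -> exists x', child x v x'.
Proof.
case: x => [i|j] hv.
  have h : (flatten_index (shape rss) i v < size (rstrips T'))%N.
    by rewrite /= size_flatten flatten_indexP // -shape_r.
  by exists (inl (Ordinal h)).
have h : (flatten_index (shape css) j v < size (cstrips T'))%N.
  by rewrite /= size_flatten flatten_indexP // -shape_c.
by exists (inr (Ordinal h)).
Qed.

Lemma child_link x y v x' y' : link_strips x y -> (v < size (split x))%N ->
  child x v x' -> child y v y' -> link_strips x' y'.
Proof.
move=> xy hv; have sxy := split_tied (connect1 xy).
have hv' := hv; rewrite sxy in hv'.
case: x y x' y' xy hv hv' {sxy} => [i|j] [i'|j'] [i1|j1] [i1'|j1'] //= xy;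
  rewrite ?shape_r ?shape_c => hv hv' -> ->;
  by rewrite -/rss -/css !flatten_indexKl ?flatten_indexKr // xy eqxx.
Qed.

(** A chain of marks lifts link by link: every strip on the way is split alike, so it has a piece
    number [v], and the mark passes to the diagonal subblock. *)
Lemma child_tied x y v x' y' : tied x y -> (v < size (split x))%N ->
  child x v x' -> child y v y' -> tied x' y'.
Proof.
move=> xy; move: x y xy x' y'; apply: tied_ind.
  by move=> x x' y' _ h1 h2; rewrite (child_inj h1 h2) /tied connect0.
move=> x y z xy IH x' z' hv hx hz.
have hv' : (v < size (split y))%N by rewrite -(split_tied (connect1 xy)).
have [y' hy] := child_ex hv'.
apply: (connect_trans (connect1 (child_link xy hv hx hy))).
exact: IH.
Qed.

Lemma child_new v x' y' : (v < e)%N -> child (inl p) v x' -> child (inr q) v y' ->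
  tied x' y'.
Proof.
move=> ve hx hy; have [h1 h2 _] := he ve; apply/connect1.
rewrite -split_row shape_r in h1; rewrite -split_col shape_c in h2.
case: x' y' hx hy => [i'|j'] [i''|j''] //= -> ->.
by rewrite -/rss -/css !flatten_indexKl ?flatten_indexKr // !eqxx ve /= orbT.
Qed.

Lemma marking_of_refine : marking_of m n T'.
Proof.
have [hm hn hmk] := hT.
split=> [||i j]; first by rewrite /= sumn_flatten -/(map sumn rss) sumn_rss.
  by rewrite /= sumn_flatten -/(map sumn css) sumn_css.
rewrite /= -/rss -/css => /andP[/eqP ho hmark].
set i0 := idx (shape rss) i in ho hmark *; set j0 := idx (shape css) j in ho hmark *.
(* An inherited mark joins equally split strips; a new mark lies among the first [e] pieces of block
   [(p, q)], which are square by [he]. *)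
have [li [lj E]] : exists (li : (i0 < size (rstrips T))%N)
    (lj : (j0 < size (cstrips T))%N),
    nth 0%N (split (inl (Ordinal li))) (off (shape rss) i) =
    nth 0%N (split (inr (Ordinal lj))) (off (shape rss) i).
  case/orP: hmark => [mij|/and3P[/eqP ip /eqP jq ve]].
    have [li lj _] := hmk _ _ mij; exists li, lj; congr (nth _ _ _).
    by apply/split_tied/connect1.
  have li : (i0 < size (rstrips T))%N by rewrite ip.
  have lj : (j0 < size (cstrips T))%N by rewrite jq.
  exists li, lj; have -> : Ordinal li = p by apply: val_inj.
  have -> : Ordinal lj = q by apply: val_inj.
  by rewrite split_row split_col; have [] := he ve.
split.
- rewrite size_flatten ltnNge; apply/negP => /idx_out.
  by rewrite -/i0 size_map size_rss => Ei; have := li; rewrite Ei ltnn.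
- rewrite size_flatten ltnNge; apply/negP => /idx_out.
  by rewrite -/j0 size_map size_css => Ej; have := lj; rewrite Ej ltnn.
by rewrite !nth_flatten -/i0 -/j0 -ho (nth_rss (Ordinal li)) (nth_css (Ordinal lj)).
Qed.

Lemma row_refine (u : 'I_m) (i : rstrip T) : idx (rstrips T) u = i ->
  idx (rstrips T') u =
    flatten_index (shape rss) i (idx (split (inl i)) (off (rstrips T) u)) /\
  off (rstrips T') u = off (split (inl i)) (off (rstrips T) u).
Proof.
move=> hu; have lu : (u < sumn (map sumn rss))%N by rewrite sumn_rss (row_lt hT).
have := idx_nested lu; rewrite sumn_rss hu nth_rss; exact.
Qed.

Lemma col_refine (u : 'I_n) (i : cstrip T) : idx (cstrips T) u = i ->
  idx (cstrips T') u =
    flatten_index (shape css) i (idx (split (inr i)) (off (cstrips T) u)) /\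
  off (cstrips T') u = off (split (inr i)) (off (cstrips T) u).
Proof.
move=> hu; have lu : (u < sumn (map sumn css))%N by rewrite sumn_css (col_lt hT).
have := idx_nested lu; rewrite sumn_css hu nth_css; exact.
Qed.

Lemma row_sub_lt (u : 'I_m) (i : rstrip T) : idx (rstrips T) u = i ->
  (off (rstrips T) u < sumn (split (inl i)))%N.
Proof. by move=> h; rewrite sumn_split; have [] := row_in hT h. Qed.

Lemma col_sub_lt (u : 'I_n) (i : cstrip T) : idx (cstrips T) u = i ->
  (off (cstrips T) u < sumn (split (inr i)))%N.
Proof. by move=> h; rewrite sumn_split; have [] := col_in hT h. Qed.

Lemma refine_same_row (u v : 'I_m) (i : rstrip T) : idx (rstrips T) u = i ->
  idx (rstrips T') u = idx (rstrips T') v ->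
  idx (rstrips T) v = i /\
  idx (split (inl i)) (off (rstrips T) u) = idx (split (inl i)) (off (rstrips T) v).
Proof.
move=> hu; have lv := reshape_indexP (row_lt hT v).
have hv : idx (rstrips T) v = Ordinal lv by [].
rewrite (row_refine hu).1 (row_refine hv).1 => E.
have lu' := reshape_indexP (row_sub_lt hu).
have lv' := reshape_indexP (row_sub_lt hv).
rewrite shape_r in lu'; rewrite shape_r in lv'.
have E1 := congr1 (idx (shape rss)) E.
have E2 := congr1 (off (shape rss)) E.
rewrite !flatten_indexKl // in E1; rewrite !flatten_indexKr // in E2.
rewrite hv; split=> //; rewrite E2; congr (idx (split (inl _)) _).
exact: val_inj.
Qed.

Lemma refine_same_col (u v : 'I_n) (i : cstrip T) : idx (cstrips T) u = i ->
  idx (cstrips T') u = idx (cstrips T') v ->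
  idx (cstrips T) v = i /\
  idx (split (inr i)) (off (cstrips T) u) = idx (split (inr i)) (off (cstrips T) v).
Proof.
move=> hu; have lv := reshape_indexP (col_lt hT v).
have hv : idx (cstrips T) v = Ordinal lv by [].
rewrite (col_refine hu).1 (col_refine hv).1 => E.
have lu' := reshape_indexP (col_sub_lt hu).
have lv' := reshape_indexP (col_sub_lt hv).
rewrite shape_c in lu'; rewrite shape_c in lv'.
have E1 := congr1 (idx (shape css)) E.
have E2 := congr1 (off (shape css)) E.
rewrite !flatten_indexKl // in E1; rewrite !flatten_indexKr // in E2.
rewrite hv; split=> //; rewrite E2; congr (idx (split (inr _)) _).
exact: val_inj.
Qed.

(** * Subblocks that a refinement makes or keeps fixed *)

Section Fixed.
Variables (C : numClosedFieldType) (A : 'M[C]_(m, n)).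
Variables (i : rstrip T) (j : cstrip T) (i' : rstrip T') (j' : cstrip T').
Variable (u : 'I_m * 'I_n).
Hypotheses (hu : in_block i j u) (hu' : in_block i' j' u).

Lemma refine_same (v : 'I_m * 'I_n) : in_block i' j' v ->
  [/\ in_block i j v,
    idx (split (inl i)) (off (rstrips T) u.1)
      = idx (split (inl i)) (off (rstrips T) v.1) &
    idx (split (inr j)) (off (cstrips T) u.2)
      = idx (split (inr j)) (off (cstrips T) v.2)].
Proof.
move=> /in_blockP[v1 v2]; have /in_blockP[u1 u2] := hu.
have /in_blockP[u1' u2'] := hu'.
have [] := refine_same_row u1 (etrans u1' (esym v1)) => w1 ->.
have [] := refine_same_col u2 (etrans u2' (esym v2)) => w2 ->.
by split=> //; apply/in_blockP.
Qed.

Let v1 := idx (split (inl i)) (off (rstrips T) u.1).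
Let v2 := idx (split (inr j)) (off (cstrips T) u.2).

Lemma child_row : (v1 < size (split (inl i)))%N /\ child (inl i) v1 (inl i').
Proof.
have /in_blockP[u1 u2] := hu; have /in_blockP[u1' u2'] := hu'.
split; first exact/reshape_indexP/row_sub_lt.
by rewrite /= -u1' (row_refine u1).1.
Qed.

Lemma child_col : (v2 < size (split (inr j)))%N /\ child (inr j) v2 (inr j').
Proof.
have /in_blockP[u1 u2] := hu; have /in_blockP[u1' u2'] := hu'.
split; first exact/reshape_indexP/col_sub_lt.
by rewrite /= -u2' (col_refine u2).1.
Qed.

(** Common core of the next three lemmas, with [z] the diagonal value of the subblock. Off the
    diagonal pieces, or for [z = 0], the subblock is zero. Otherwise the middle hypothesis makes
    piece [v1] start at the same offset in rows and columns, so the diagonal of the old block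
    restricts to that of the subblock. *)
Lemma fixed_subblock z :
  (forall v : 'I_m * 'I_n, in_block i j v ->
     idx (split (inl i)) (off (rstrips T) v.1) = v1 ->
     idx (split (inr j)) (off (cstrips T) v.2) = v2 ->
     A v.1 v.2 = if (v1 == v2) && (off (rstrips T) v.1 == off (cstrips T) v.2)
                 then z else 0) ->
  (v1 = v2 -> z != 0 -> split (inl i) = split (inr j) \/
     exists2 ds, (v1 < size ds)%N & exists a b,
       split (inl i) = rcons ds a /\ split (inr j) = rcons ds b) ->
  (v1 = v2 -> z != 0 -> tied (inl i') (inr j')) ->
  fixed_block A i' j'.
Proof.
move=> hA hsp ht; have [E|E] := eqVneq v1 v2; last first.
  by left=> v /refine_same[h1 h2 h3]; rewrite hA // (negPf E).
have [z0|z0] := eqVneq z 0.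
  by left=> v /refine_same[h1 h2 h3]; rewrite hA // z0; case: ifP.
right; split; first exact: ht.
exists z => v hv; have [h1 h2 h3] := refine_same hv.
rewrite hA // E eqxx /= /on_block_diagonal.
have /in_blockP[w1 w2] := h1.
rewrite (row_refine w1).2 (col_refine w2).2.
set o1 := off (rstrips T) v.1; set o2 := off (cstrips T) v.2.
suff -> : (o1 == o2) = (off (split (inl i)) o1 == off (split (inr j)) o2) by [].
have k1 : idx (split (inl i)) o1 = v1 by [].
have k2 : idx (split (inr j)) o2 = v1 by rewrite E.
rewrite -{1}(idx_off (split (inl i)) o1) -{1}(idx_off (split (inr j)) o2) k1 k2.
suff -> : start (split (inl i)) v1 = start (split (inr j)) v1 by rewrite eqn_add2l.
by have [->|[ds lv [a [b [-> ->]]]]] := hsp E z0; rewrite // !start_rcons // ltnW.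
Qed.

(** A scalar block has tied strips, which are split alike: its diagonal subblocks are scalar and
    again tied, the others are zero. *)
Lemma fixed_refine : fixed_block A i j -> fixed_block A i' j'.
Proof.
case=> [A0|[tij [z Az]]].
  by left=> v /refine_same[hv _ _]; apply: A0.
have sp := split_tied tij.
apply: (@fixed_subblock z) => [v hv h1 h2|_ _|E _]; last 1 first.
- have [lt cr] := child_row; have [_ cc] := child_col.
  by apply: (child_tied tij lt) => //; rewrite -/v2 -E in cc.
- rewrite Az // /on_block_diagonal; case: eqP => [E|]; last by rewrite andbF.
  by rewrite -h1 -h2 E sp eqxx.
- by left.
Qed.

Lemma fixed_similarity (lam : nat -> C) : i = p -> j = q ->
  tied (inl p) (inr q) ->
  (forall v : 'I_m * 'I_n, in_block i j v ->
     (idx dr (off (cstrips T) v.2) <= idx dr (off (rstrips T) v.1))%N ->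
     A v.1 v.2 = if on_block_diagonal T v
                 then lam (idx dr (off (rstrips T) v.1)) else 0) ->
  (idx dr (off (cstrips T) u.2) <= idx dr (off (rstrips T) u.1))%N ->
  fixed_block A i' j'.
Proof.
move=> ip jq tpq hA hle; have Er : split (inl i) = dr by rewrite ip split_row.
have Ec : split (inr j) = dr by rewrite jq split_col htie.
apply: (@fixed_subblock (lam v1)) => [v hv|_ _|E _]; last 1 first.
- have [lt cr] := child_row; have [_ cc] := child_col.
  rewrite ip jq in lt cr cc *.
  by apply: (child_tied tpq lt) => //; rewrite -/v2 -E in cc.
- rewrite /v1 /v2 Er Ec => h1 h2; rewrite hA ?h1 ?h2 // /on_block_diagonal.
  case: eqP => [E|]; last by rewrite andbF.
  by rewrite -h1 -h2 E eqxx.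
- by left; rewrite Er Ec.
Qed.

Lemma fixed_equivalence ds a b (av : nat -> C) : i = p -> j = q ->
  ~~ tied (inl p) (inr q) ->
  dr = rcons ds a -> dc = rcons ds b -> e = size ds ->
  (forall v : 'I_m * 'I_n, in_block i j v ->
     A v.1 v.2 = if on_block_diagonal T v && (off (rstrips T) v.1 < sumn ds)%N
                 then av (idx ds (off (rstrips T) v.1)) else 0) ->
  fixed_block A i' j'.
Proof.
move=> ip jq tpq Edr Edc Ee hA.
have Er : split (inl i) = rcons ds a by rewrite ip split_row.
have Ec : split (inr j) = rcons ds b by rewrite jq split_col.
(* The last piece belongs to the zero summand of (1), which receives no mark and needs none. *)
pose z := if (v1 < size ds)%N then av v1 else 0.
have zlt : z != 0 -> (v1 < size ds)%N by rewrite /z; case: ifP; rewrite ?eqxx.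
apply: (@fixed_subblock z) => [v hv|E z0|E z0]; last 1 first.
- have [lt cr] := child_row; have [_ cc] := child_col.
  rewrite ip in cr; rewrite jq -/v2 -E in cc.
  by apply: (child_new _ cr cc); rewrite Ee zlt.
- have /in_blockP[w1 w2] := hv.
  have := row_sub_lt w1; have := col_sub_lt w2; rewrite Er Ec !sumn_rcons => l2 l1.
  move=> h1 h2; rewrite hA // /on_block_diagonal.
  case: eqP => [o12|]; last by rewrite andbF.
  rewrite -o12 in l2 h2; case: ltnP => lo /=.
    rewrite (idx_rcons _ lo).1 in h1; rewrite (idx_rcons _ lo).1 in h2.
    by rewrite -h1 -h2 eqxx /z -h1 reshape_indexP.
  by rewrite andbT /z -h1 (idx_rcons_last lo) // ltnn if_same.
- right; exists ds; first exact: zlt.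
  by exists a, b.
Qed.

End Fixed.
End Refine.

(** * Normal forms of one block *)

Section Forms.
Variable C : numClosedFieldType.

Lemma entry_window (V : nmodType) m n (A : 'M[V]_(m, n)) a b h w x y :
  (x < h)%N -> (y < w)%N ->
  entry (window A a b h w) x y = entry A (a + x) (b + y).
Proof.
move=> hx hy; rewrite -[x]/(val (Ordinal hx)) -[y]/(val (Ordinal hy)).
by rewrite entryE mxE.
Qed.

(** One entrywise formula replaces the separate conditions on blocks below and on the block
    diagonal, and no block with a computed size is left in it. *)
Lemma similarity_formE h w ds lam (F : 'M[C]_(h, w)) :
  similarity_form ds lam F <->
  [/\ size lam = size ds /\ all (ltn 0) ds,
      sumn ds = h /\ sumn ds = w,
      sorted (fun x y => clex_le y x) lam,
      (forall x y, (x < sumn ds)%N -> (y < sumn ds)%N ->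
         (idx ds y <= idx ds x)%N ->
         entry F x y = if x == y then nth 0 lam (idx ds x) else 0) &
      forall i, (i.+1 < size ds)%N -> nth 0 lam i = nth 0 lam i.+1 ->
        row_free (window F (start ds i) (start ds i.+1)
                    (nth 0%N ds i) (nth 0%N ds i.+1))^T].
Proof.
split=> [[h1 h2 h3 [h4 h5] h6]|[h1 h2 h3 h4 h6]].
  split=> // x y hx hy; have lx := reshape_indexP hx; have ly := reshape_indexP hy.
  have ox := reshape_offsetP hx; have oy := reshape_offsetP hy.
  rewrite leq_eqVlt => /orP[/eqP E|lt].
    have ey := idx_off ds y; rewrite E in oy ey.
    have /matrixP := h5 (Ordinal lx).
    move/(_ (Ordinal ox) (Ordinal oy)); rewrite !mxE /= idx_off ey => ->.
    have -> : (x == y) = (off ds x == off ds y).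
      by rewrite -{1}(idx_off ds x) -{1}ey eqn_add2l.
    by rewrite -val_eqE /=; case: ifP; rewrite ?mulr1n ?mulr0n.
  have /matrixP := h4 (Ordinal lx) (Ordinal ly) lt.
  move/(_ (Ordinal ox) (Ordinal oy)); rewrite !mxE /= !idx_off => ->.
  by case: eqP lt => // ->; rewrite ltnn.
split=> //; split=> [i j ji|i]; apply/matrixP=> x y; rewrite !mxE h4 ?start_sumn
  ?idx_start // ?(ltnW ji) //.
  case: eqP => // E; move: ji.
  by rewrite -(idx_start (ltn_ord x)) -{1}(idx_start (ltn_ord y)) E ltnn.
by rewrite eqn_add2l -val_eqE; case: ifP; rewrite ?mulr1n ?mulr0n.
Qed.

Lemma row_free_row_neq0 p q (B : 'M[C]_(p, q)) i : row_free B -> row i B <> 0.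
Proof.
move/row_free_inj => inj; rewrite rowE -[RHS](mul0mx _ B) => /inj/matrixP/(_ 0 i).
by rewrite !mxE !eqxx => /eqP; rewrite oner_eq0.
Qed.

(** Positive terms and equal sums exclude that one list is a proper prefix of the other, so the
    lists differ at a position valid in both. *)
Lemma first_difference (s t : seq nat) : all (ltn 0) s -> all (ltn 0) t ->
  sumn s = sumn t -> s <> t ->
  exists k, [/\ start s k = start t k, (k < size s)%N, (k < size t)%N &
                nth 0%N s k <> nth 0%N t k].
Proof.
elim: s t => [|a s IH] [|b t] //=; first by move=> _ /andP[]; lia.
  by move=> /andP[]; lia.
move=> /andP[pa ps] /andP[pb pt] E ne.
case: (eqVneq a b) => [ab|/eqP nab]; last by exists 0%N.
have [|k [h1 h2 h3 h4]] := IH t ps pt _ (fun e => ne (congr2 cons ab e)); first lia.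
by exists k.+1; split=> //=; rewrite /start /= ab in h1 *; congr addn.
Qed.

(* If ds and ds' first differ at the strip k, where ds is the shorter, then the
   first column of the block F_{k,k+1} for ds lies in the scalar block F_kk for ds',
   so it vanishes although the two eigenvalues agree. *)
Lemma similarity_form_uniq h w ds lam ds' lam' (F : 'M[C]_(h, w)) :
  similarity_form ds lam F -> similarity_form ds' lam' F -> ds = ds'.
Proof.
move=> /similarity_formE[[s1 p1] [e1 _] _ F1 r1].
move=> /similarity_formE[[s2 p2] [e2 _] _ F2 r2].
apply: contrapT => /(first_difference p1 p2 (etrans e1 (esym e2))).
case=> k [st k1 k2]; move: e1 e2 => <- E21.
have aux (d d' : seq nat) l l' : all (ltn 0) d -> all (ltn 0) d' ->
  sumn d = sumn d' ->
  (forall x y, (x < sumn d)%N -> (y < sumn d)%N ->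
         (idx d y <= idx d x)%N ->
         entry F x y = if x == y then nth 0 l (idx d x) else 0) ->
  (forall x y, (x < sumn d')%N -> (y < sumn d')%N ->
         (idx d' y <= idx d' x)%N ->
         entry F x y = if x == y then nth 0 l' (idx d' x) else 0) ->
  (forall i, (i.+1 < size d)%N -> nth 0 l i = nth 0 l i.+1 ->
        row_free (window F (start d i) (start d i.+1)
                    (nth 0%N d i) (nth 0%N d i.+1))^T) ->
  start d k = start d' k -> (k < size d)%N -> (k < size d')%N ->
  (nth 0%N d k < nth 0%N d' k)%N -> False.
  move=> pd pd' es F1' F2' r st' kd kd' lt.
  have le := start_nth_le d' k.
  have k3 : (k.+1 < size d)%N.
    rewrite ltn_neqAle kd andbT; apply/eqP => E.
    have : start d k.+1 = sumn d by rewrite E /start take_size.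
    by rewrite startS; lia.
  have n1 := nth_pos pd kd; have n2 := nth_pos pd k3; have n3 := nth_pos pd' kd'.
  have i1 := idx_start n1; have i2 := idx_start n2; rewrite !addn0 in i1 i2.
  have i3 x : (x < nth 0 d' k)%N -> idx d' (start d k + x) = k.
    by rewrite st'; apply: idx_start.
  have sk := startS d k.
  have l2 := start_sumn n2; rewrite addn0 in l2.
  have eqlam : nth 0 l k = nth 0 l k.+1.
    have := F1' (start d k) (start d k); rewrite i1 eqxx => <- //; last by lia.
      have := F1' (start d k.+1) (start d k.+1); rewrite i2 eqxx => <- //.
      rewrite !F2' -?es ?eqxx //; try lia.
      by rewrite -[start d k]addn0 i3 // sk i3.
    by lia.
  have := r k k3 eqlam => /(@row_free_row_neq0 _ _ _ (Ordinal n2)); apply.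
  apply/matrixP => x y; have hy := ltn_ord y; rewrite !mxE /= addn0 F2'.
  - by case: eqP => // E; exfalso; move: E hy sk; lia.
  - by rewrite -es; lia.
  - by rewrite -es; lia.
  by rewrite i3 ?sk ?i3 //; lia.
move=> ne; have [lt|lt|//] := ltngtP (nth 0%N ds k) (nth 0%N ds' k).
  exact: (aux ds ds' lam lam').
exact: (aux ds' ds lam' lam).
Qed.

(** The default 0 of [nth] beyond [sumn ds] produces the final zero summand of (1). *)
Lemma nth_flatten_nseq (ds : seq nat) (a : seq C) x : size a = size ds ->
  nth 0 (flatten [seq nseq p.1 p.2 | p <- zip ds a]) x
  = if (x < sumn ds)%N then nth 0 a (idx ds x) else 0.
Proof.
move=> sa; set ss := map _ _.
have sh : shape ss = ds.
  rewrite /shape /ss -map_comp -[RHS](@unzip1_zip _ _ ds a) ?sa //.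
  by apply: eq_map => z /=; rewrite size_nseq.
case: ltnP => hx; last by rewrite nth_default // size_flatten sh.
rewrite nth_flatten sh (nth_map (0%N, 0)) ?nth_zip //=; last first.
  by rewrite size_zip sa minnn reshape_indexP.
by rewrite nth_nseq reshape_offsetP.
Qed.

Lemma sorted_pos (a : seq C) i : sorted >%R (rcons a 0) -> (i < size a)%N ->
  0 < nth 0 a i.
Proof.
rewrite sorted_pairwise; last by move=> y x z xy yz; apply: lt_trans yz xy.
by rewrite pairwise_rcons => /andP[/allP h _] hi; apply: h; rewrite mem_nth.
Qed.

Lemma decreasing_nth (a : seq C) i k : sorted >%R (rcons a 0) -> (i < k)%N ->
  (k < size a)%N -> nth 0 a k < nth 0 a i.
Proof.
rewrite sorted_pairwise; last by move=> y x z xy yz; apply: lt_trans yz xy.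
rewrite pairwise_rcons => /andP[_ /(pairwiseP 0) h] ik hk.
by apply: h; rewrite // inE ?(ltn_trans ik).
Qed.

Lemma leq_idx ds x y : (x <= y)%N -> (idx ds x <= idx ds y)%N.
Proof. by rewrite (reshape_leq ds) => /orP[/ltnW//|/andP[/eqP->]]. Qed.

Section Block.
Variables (m n : nat) (T : marking).
Hypothesis hT : marking_of m n T.
Variables (A : 'M[C]_(m, n)) (i : rstrip T) (j : cstrip T).

Lemma equivalence_blkE ds a :
  equivalence_form ds a (blk T A i j) <->
  [/\ size a = size ds, all (ltn 0) ds,
      (sumn ds <= minn (nth 0 (rstrips T) i) (nth 0 (cstrips T) j))%N,
      sorted >%R (rcons a 0) &
      forall u : 'I_m * 'I_n, in_block i j u ->
        A u.1 u.2 =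
        if on_block_diagonal T u && (off (rstrips T) u.1 < sumn ds)%N
        then nth 0 a (idx ds (off (rstrips T) u.1)) else 0].
Proof.
pose P (x y : nat) v := v = if x == y then nth 0
  (flatten [seq nseq p.1 p.2 | p <- zip ds a]) x else 0 :> C.
have E : size a = size ds -> (forall u : 'I_m * 'I_n, in_block i j u ->
        A u.1 u.2 =
        if on_block_diagonal T u && (off (rstrips T) u.1 < sumn ds)%N
        then nth 0 a (idx ds (off (rstrips T) u.1)) else 0) <->
   (forall (x : 'I_(nth 0%N (rstrips T) i)) (y : 'I_(nth 0%N (cstrips T) j)),
      P x y (blk T A i j x y)).
  move=> sa; rewrite (forall_blk hT A i j P); split=> h u hu; have := h u hu;
  by rewrite /P nth_flatten_nseq // /on_block_diagonal; case: eqP.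
split=> [[h1 h2 h3 h4 h5]|[h1 h2 h3 h4 /(E h1) h5]]; split=> //.
  by apply/(E h1) => x y; rewrite /P {1}h5 mxE.
by apply/matrixP => x y; rewrite h5 mxE.
Qed.

(** The right-hand side depends on [ds] and not on the values [a]: two blocks of form (1) with
    common sizes have their circles in the same places. *)
Lemma equivalence_neq0 ds a (u : 'I_m * 'I_n) :
  equivalence_form ds a (blk T A i j) -> in_block i j u ->
  (A u.1 u.2 != 0) =
  on_block_diagonal T u && (off (rstrips T) u.1 < sumn ds)%N.
Proof.
move=> /equivalence_blkE[sa _ _ srt hA] hu; rewrite hA //.
case: ifP => [/andP[_ lo]|]; last by rewrite eqxx.
by rewrite gt_eqF //; apply: sorted_pos => //; rewrite sa reshape_indexP.
Qed.

(** Since [a] is strictly decreasing, the lines between circles are likewise determined by [ds]. *)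
Lemma equivalence_eq ds a (u v : 'I_m * 'I_n) :
  equivalence_form ds a (blk T A i j) -> in_block i j u -> in_block i j v ->
  on_block_diagonal T u && (off (rstrips T) u.1 < sumn ds)%N ->
  on_block_diagonal T v && (off (rstrips T) v.1 < sumn ds)%N ->
  (A u.1 u.2 = A v.1 v.2 <->
   idx ds (off (rstrips T) u.1) = idx ds (off (rstrips T) v.1)).
Proof.
move=> /equivalence_blkE[sa _ _ srt hA] hu hv du dv.
rewrite !hA // du dv; split=> [e|->//].
case/andP: du => _ /reshape_indexP du; case/andP: dv => _ /reshape_indexP dv.
rewrite -sa in du dv.
case: (ltngtP (idx ds (off (rstrips T) u.1)) (idx ds (off (rstrips T) v.1))) => // h.
  by have := decreasing_nth srt h dv; rewrite e ltxx.
by have := decreasing_nth srt h du; rewrite e ltxx.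
Qed.

Lemma similarity_blkE ds lam :
  similarity_form ds lam (blk T A i j) <->
  [/\ size lam = size ds /\ all (ltn 0) ds,
      sumn ds = nth 0%N (rstrips T) i /\ sumn ds = nth 0%N (cstrips T) j,
      sorted (fun x y => clex_le y x) lam,
      (forall u : 'I_m * 'I_n, in_block i j u ->
         (idx ds (off (cstrips T) u.2) <= idx ds (off (rstrips T) u.1))%N ->
         A u.1 u.2 = if on_block_diagonal T u
                     then nth 0 lam (idx ds (off (rstrips T) u.1)) else 0) &
      forall v, (v.+1 < size ds)%N -> nth 0 lam v = nth 0 lam v.+1 ->
        row_free (window A (start (rstrips T) i + start ds v)
                    (start (cstrips T) j + start ds v.+1)
                    (nth 0%N ds v) (nth 0%N ds v.+1))^T].
Proof.
have ww v : sumn ds = nth 0%N (rstrips T) i -> sumn ds = nth 0%N (cstrips T) j ->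
  window (blk T A i j) (start ds v) (start ds v.+1) (nth 0%N ds v) (nth 0%N ds v.+1)
  = window A (start (rstrips T) i + start ds v)
     (start (cstrips T) j + start ds v.+1) (nth 0%N ds v) (nth 0%N ds v.+1).
  move=> e1 e2; apply/matrixP => x y; rewrite !mxE entry_window -?e1 -?e2
    ?start_sumn //.
  by rewrite !addnA.
have ent u : in_block i j u -> A u.1 u.2 = entry (blk T A i j)
    (off (rstrips T) u.1) (off (cstrips T) u.2).
  move=> /in_blockP[/(row_in hT)[e1 l1] /(col_in hT)[e2 l2]].
  by rewrite entry_window // -e1 -e2 entryE.
rewrite similarity_formE; split=> -[h1 [e1 e2] h3 h4 h5]; split=> //.
- move=> u hu le; rewrite ent // h4 // ?e1 ?e2 //.
  + by have /in_blockP[/(row_in hT)[_ ->]] := hu.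
  + by have /in_blockP[_ /(col_in hT)[_]] := hu; rewrite -e1 -e2.
- by move=> v hv e; rewrite -ww //; apply: h5.
- move=> x y hx hy le; have hx' := hx; have hy' := hy.
  rewrite e1 in hx'; rewrite e2 in hy'.
  have [r er] := row_at hT hx'; have [c ec] := col_at hT hy'.
  have := h4 (r, c); rewrite ent /on_block_diagonal /in_block /= ?er ?ec
    ?idx_start ?off_start ?eqxx //; exact.
- by move=> v hv e; rewrite ww //; apply: h5.
Qed.

Lemma blk_nonempty (u : 'I_m * 'I_n) : in_block i j u ->
  (0 < nth 0 (rstrips T) i)%N /\ (0 < nth 0 (cstrips T) j)%N.
Proof. by move=> /in_blockP[/(row_in hT)[_ l1] /(col_in hT)[_ l2]]; split; lia. Qed.

Lemma in_block_at x y : (x < nth 0 (rstrips T) i)%N -> (y < nth 0 (cstrips T) j)%N ->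
  exists u : 'I_m * 'I_n, [/\ in_block i j u, off (rstrips T) u.1 = x &
    off (cstrips T) u.2 = y].
Proof.
move=> hx hy; have [r er] := row_at hT hx; have [c ec] := col_at hT hy.
by exists (r, c); rewrite /in_block /= er ec !idx_start // !off_start // !eqxx.
Qed.

Lemma idx1 h x : (x < h)%N -> idx [:: h] x = 0%N.
Proof. by move=> hx; have := @idx_start [:: h] 0 x hx. Qed.

(** [nseq (0 < h) h] is the list with the single size [h], and the empty list for an empty block,
    because (2) admits only positive sizes. *)
Lemma fixed_similarity_form : tied (inl i) (inr j) -> fixed_block A i j ->
  exists z, let h := nth 0%N (rstrips T) i in
    similarity_form (nseq (0 < h) h) (nseq (0 < h) z) (blk T A i j).
Proof.
move=> tij fA; have sz := tied_size hT tij; rewrite /= in sz.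
have [z Az] : exists z, scalar_block A i j z.
  case: fA => [A0|[_ //]]; exists 0 => u hu; rewrite A0 //; by case: ifP.
exists z => /=; case: (posnP (nth 0%N (rstrips T) i)) => h0.
  apply/similarity_blkE; split=> //; first by rewrite -sz h0.
  by move=> u /blk_nonempty; rewrite h0; case.
apply/similarity_blkE; split=> //=; rewrite ?h0 ?addn0 //.
move=> u hu _; rewrite Az //; have /in_blockP[/(row_in hT)[_ l1] _] := hu.
by rewrite idx1.
Qed.

Lemma fixed_equivalence_form : ~~ tied (inl i) (inr j) -> fixed_block A i j ->
  equivalence_form [::] [::] (blk T A i j).
Proof.
move=> nt [A0|[tij _]]; last by rewrite tij in nt.
apply/equivalence_blkE; split=> // u hu.
by rewrite A0 // andbF.
Qed.

(** By uniqueness of the sizes, [ds] alone decides whether the block is fixed. The quantification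
    over [u] covers empty blocks, which are fixed although their [ds] is empty. *)
Lemma similarity_fixed ds lam : tied (inl i) (inr j) ->
  similarity_form ds lam (blk T A i j) ->
  (fixed_block A i j <-> (forall u : 'I_m * 'I_n, in_block i j u -> size ds = 1%N)).
Proof.
move=> tij sf; split=> [/(fixed_similarity_form tij)[z sf'] u hu|h].
  by rewrite (similarity_form_uniq sf sf') size_nseq (blk_nonempty hu).1.
have [[u hu]|ne] := pselect (exists u : 'I_m * 'I_n, in_block i j u); last first.
  by left=> u hu; case: ne; exists u.
have [_ [e1 e2] _ hA _] := (similarity_blkE _ _).1 sf.
have := h u hu; case: ds {sf h} e1 e2 hA => [|d []] //=; rewrite addn0 => e1 e2 hA _.
right; split=> //; exists (nth 0 lam 0) => v hv.
have /in_blockP[/(row_in hT)[_ l1] /(col_in hT)[_ l2]] := hv.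
rewrite -e1 in l1; rewrite -e2 in l2.
by rewrite hA // !idx1.
Qed.

Lemma equivalence_fixed ds a : ~~ tied (inl i) (inr j) ->
  equivalence_form ds a (blk T A i j) -> (fixed_block A i j <-> ds = [::]).
Proof.
move=> nt /equivalence_blkE[sa pd le srt hA]; split=> [[A0|[tij _]]|E].
- case: ds sa pd le srt hA => // d ds sa /= /andP[d0 pd] le srt hA.
  have [||u [hu o1 o2]] := @in_block_at 0 0; [lia|lia|].
  have := hA u hu; rewrite A0 // /on_block_diagonal o1 o2 eqxx /= addn_gt0 d0 /=.
  have -> : idx (d :: ds) 0 = 0%N by have := @idx_start (d :: ds) 0 0 d0.
  by move=> E0; have := @sorted_pos a 0 srt; rewrite sa -E0 ltxx => /(_ isT).
- by rewrite tij in nt.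
by left=> u hu; rewrite hA // E /= andbF.
Qed.

End Block.

(* Asking this for every form of the block of A makes it unnecessary to know that
   the sizes in the form (1) are unique. *)
Definition matching m n (T : marking) (A B : 'M[C]_(m, n)) (i : rstrip T)
    (j : cstrip T) :=
  if tied (inl i) (inr j) then
    forall ds lam, similarity_form ds lam (blk T A i j) ->
      exists lam', similarity_form ds lam' (blk T B i j)
  else forall ds a, equivalence_form ds a (blk T A i j) ->
      exists a', equivalence_form ds a' (blk T B i j).

(** * Canonical parts, and blocks of equal shape in two matrices *)

Section Canonical.
Variables (m n : nat) (T : marking).
Hypothesis hT : marking_of m n T.
Implicit Types (A B : 'M[C]_(m, n)) (i : rstrip T) (j : cstrip T).
Implicit Types (Z : {set 'I_m * 'I_n}).

Lemma matching_refl A i j : matching A A i j.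
Proof. by rewrite /matching; case: ifP => _ ds a h; exists a. Qed.

(** The canonical part guarantees that the block of [A] has a normal form; without one, [matching]
    would hold vacuously. *)
Lemma matching_fixed A B i j Z : canonical_part A i j Z -> matching A B i j ->
  (fixed_block A i j <-> fixed_block B i j).
Proof.
rewrite /canonical_part /matching; case: ifPn => t [ds [a [fA _]]] /(_ _ _ fA)[b fB].
  by rewrite (similarity_fixed hT t fA) (similarity_fixed hT t fB).
by rewrite (equivalence_fixed hT t fA) (equivalence_fixed hT t fB).
Qed.

Lemma fixed_matching A B i j : fixed_block A i j -> fixed_block B i j ->
  matching A B i j.
Proof.
move=> fA fB; rewrite /matching; case: ifPn => t ds a.
  have [z sA] := fixed_similarity_form hT t fA.
  have [z' sB] := fixed_similarity_form hT t fB.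
  by move/similarity_form_uniq => /(_ _ _ sA) ->; eexists; exact: sB.
move=> fA'; have -> := (equivalence_fixed hT t fA').1 fA.
by exists [::]; apply: fixed_equivalence_form.
Qed.

Lemma fixed_canonical A i j : fixed_block A i j -> exists Z, canonical_part A i j Z.
Proof.
move=> fA; case: (boolP (tied (inl i) (inr j))) => t.
  have [z sA] := fixed_similarity_form hT t fA.
  by eexists; rewrite /canonical_part t; do 2 eexists; split; first exact: sA.
eexists; rewrite /canonical_part (negPf t).
by do 2 eexists; split; first exact: (fixed_equivalence_form hT t fA).
Qed.

Lemma canonical_part_block A i j Z u : canonical_part A i j Z -> u \in Z ->
  in_block i j u.
Proof.
rewrite /canonical_part; case: ifP => _ [ds [a [_ ->]]]; rewrite inE //.
by case/andP.
Qed.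

Lemma fixed_part A i j Z u : fixed_block A i j -> canonical_part A i j Z ->
  (u \in Z) = in_block i j u.
Proof.
move=> fA; rewrite /canonical_part; case: ifPn => t [ds [a [sf ->]]]; rewrite inE //.
case hu : (in_block i j u) => //=.
have [_ [e1 e2] _ _ _] := (similarity_blkE hT _ _ _ _ _).1 sf.
have := (similarity_fixed hT t sf).1 fA u hu.
have /in_blockP[/(row_in hT)[_ l1] /(col_in hT)[_ l2]] := hu.
by case: ds {sf} e1 e2 => [|d []] //=; rewrite addn0 => e1 e2 _;
  rewrite -e1 in l1; rewrite -e2 in l2; rewrite !idx1.
Qed.

Lemma canonical_part_uniq A i j Z Z' : canonical_part A i j Z ->
  canonical_part A i j Z' -> Z = Z'.
Proof.
rewrite /canonical_part; case: ifPn => t [ds [a [sf ->]]] [ds' [a' [sf' ->]]] //.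
by rewrite (similarity_form_uniq sf sf').
Qed.

Lemma matching_canonical A B i j Z0 Z : canonical_part A i j Z0 ->
  matching A B i j -> (canonical_part A i j Z <-> canonical_part B i j Z).
Proof.
rewrite /canonical_part /matching; case: ifPn => t [ds [a [fA _]]] mAB;
  have [b fB] := mAB _ _ fA; split=> -[ds' [c [f' ->]]].
- by have [c' fB'] := mAB _ _ f'; exists ds', c'.
- by rewrite (similarity_form_uniq f' fB); exists ds, a.
- by have [c' fB'] := mAB _ _ f'; exists ds', c'.
(* An equivalence part is the whole block whatever the sizes, so the form known for [A] serves. *)
by exists ds, a.
Qed.

End Canonical.
End Forms.

(** * Derived matrices and zones *)

Section Step.
Variables (C : numClosedFieldType) (m n : nat) (T : marking).
Hypothesis hT : marking_of m n T.
Variable A : 'M[C]_(m, n).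

Definition same_block U (u v : 'I_m * 'I_n) :=
  idx (rstrips U) u.1 = idx (rstrips U) v.1 /\
  idx (cstrips U) u.2 = idx (cstrips U) v.2.

Lemma block_le_anti u v : block_le u v -> block_le v u -> u = v.
Proof.
by case: u v => [a b] [c d]; rewrite /block_le /= => h1 h2; congr pair; lia.
Qed.

Lemma block_le_total u v : ~~ block_le u v -> block_le v u.
Proof. by case: u v => [a b] [c d]; rewrite /block_le /=; lia. Qed.

Lemma first_changed_uniq (p p' : rstrip T) (q q' : cstrip T) :
  first_changed A p q -> first_changed A p' q' -> p = p' /\ q = q'.
Proof.
move=> [c h] [c' h'].
by have [/val_inj -> /val_inj ->] := block_le_anti (h _ _ c') (h' _ _ c).
Qed.

(** The derivations behind a scheme keep the matrix constant and only add divisions and marks. *)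
Lemma equivalent_refl : equivalent T A A.
Proof.
exists 1%:M, 1%:M; split; last by rewrite invmx1 mul1mx mulmx1.
have [hm hn sz] := hT.
have u1 p : (1%:M : 'M[C]_p) \is unitarymx.
  by apply/unitarymxP; rewrite mul1mx trmx1 map_mx1.
have bd p (ds : seq nat) : sumn ds = p -> block_diagonal ds (1%:M : 'M[C]_p).
  by move=> e; apply/(block_diagonalP e) => x y xy; rewrite mxE;
    case: (x =P y) xy => [->|//]; rewrite eqxx.
have e1 p a b : (a < p)%N -> (b < p)%N -> entry (1%:M : 'M[C]_p) a b = (a == b)%:R.
  move=> ha hb; rewrite -[a]/(val (Ordinal ha)) -[b]/(val (Ordinal hb)).
  by rewrite entryE mxE.
split=> // [||i j ij]; [exact: bd|exact: bd|].
have [_ _ es] := sz _ _ ij.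
apply/matrixP => x y; have lx := ltn_ord x; have ly := ltn_ord y.
rewrite !mxE !e1 ?eqn_add2l //; try (by rewrite -?hm start_sumn);
  by rewrite -[X in (_ < X)%N]hn start_sumn // -es.
Qed.

(** Brings the two cases of [derived] to one refinement with the properties that the lemmas on
    refinements require, so that only the last clause distinguishes (1) from (2). *)
Lemma derived_split T' : derived T A T' A ->
  exists (p : rstrip T) (q : cstrip T), first_changed A p q /\
  exists dr dc e,
  [/\ T' = refine p q dr dc e,
   [/\ sumn dr = nth 0%N (rstrips T) p, sumn dc = nth 0%N (cstrips T) q,
      (tied (inl p) (inr q) -> dr = dc) &
      (forall v, (v < e)%N ->
        [/\ (v < size dr)%N, (v < size dc)%N & nth 0%N dr v = nth 0%N dc v])] &
   if tied (inl p) (inr q) then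
     exists lam, similarity_form dr lam (blk T A p q)
   else exists ds a b, [/\ dr = rcons ds a, dc = rcons ds b, e = size ds &
     exists al, equivalence_form ds al (blk T A p q)]].
Proof.
case=> p [q [fc _]] /=; case: ifPn => t [ds [a [f ->]]]; exists p, q; split=> //.
  exists ds, ds, 0%N; split=> //; last by rewrite t; exists a.
  by have [_ [e1 e2] _ _ _] := (similarity_blkE hT _ _ _ _ _).1 f; split.
have [_ _ le _ _] := (equivalence_blkE hT _ _ _ _ _).1 f.
do 3 eexists; split; first reflexivity; last first.
  by rewrite (negPf t); exists ds; do 2 eexists; split=> //; exists a.
rewrite !sumn_rcons; split; [lia|lia|by rewrite (negPf t)|].
by move=> v hv; rewrite !size_rcons !nth_rcons hv; split; lia.
Qed.

Section Derived.
Variable T' : marking.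
Hypothesis dA : derived T A T' A.

Lemma derived_marking : marking_of m n T'.
Proof.
have [p [q [_ [dr [dc [e [-> [h1 h2 h3 h4] _]]]]]]] := derived_split dA.
exact: marking_of_refine.
Qed.

Lemma derived_same (u v : 'I_m * 'I_n) : same_block T' u v -> same_block T u v.
Proof.
have [p [q [_ [dr [dc [e [-> [h1 h2 h3 h4] _]]]]]]] := derived_split dA.
case=> E1 E2.
have l1 := reshape_indexP (row_lt hT u.1).
have l2 := reshape_indexP (col_lt hT u.2).
have [w1 _] := refine_same_row hT h1 h2 h3 (erefl : _ = nat_of_ord (Ordinal l1)) E1.
have [w2 _] := refine_same_col hT h1 h2 h3 (erefl : _ = nat_of_ord (Ordinal l2)) E2.
by split; rewrite ?w1 ?w2.
Qed.

Lemma derived_fixed (B : 'M[C]_(m, n)) (i : rstrip T) (j : cstrip T)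
    (i' : rstrip T') (j' : cstrip T') (u : 'I_m * 'I_n) :
  in_block i j u -> in_block i' j' u -> fixed_block B i j -> fixed_block B i' j'.
Proof.
have [p [q [_ [dr [dc [e [E [h1 h2 h3 h4] _]]]]]]] := derived_split dA.
by subst T' => hu hu'; apply: (fixed_refine hT h1 h2 h3 hu hu').
Qed.

(** The refinement is dictated by [A], yet its effect on [B] is the same as soon as the block of [B]
    has a form with the same sizes. *)
Lemma derived_part (B : 'M[C]_(m, n)) (i : rstrip T) (j : cstrip T) Z
    (i' : rstrip T') (j' : cstrip T') (u : 'I_m * 'I_n) :
  first_changed A i j -> canonical_part A i j Z -> matching A B i j ->
  u \in Z -> in_block i' j' u -> fixed_block B i' j'.
Proof.
have [p [q [fc [dr [dc [e [E [h1 h2 h3 h4] hf]]]]]]] := derived_split dA.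
move=> /(first_changed_uniq fc)[<- <-] cZ; subst T'.
have cb := canonical_part_block cZ.
move: cZ; rewrite /canonical_part /matching.
case: ifPn hf => t.
  case=> lam sf [ds [lam' [sf' EZ]]] mAB uZ hu'.
  have [lam2 /(similarity_blkE hT)[_ [e1 e2] _ hB _]] := mAB _ _ sf.
  apply: (fixed_similarity hT h1 h2 h3 (cb u uZ) hu' erefl erefl t hB).
  by move: uZ; rewrite EZ inE (similarity_form_uniq sf sf') => /andP[].
case=> ds [a [b [E1 E2 E3 [al ef]]]] _ mAB uZ hu'.
have [al' /(equivalence_blkE hT)[_ _ _ _ hB]] := mAB _ _ ef.
exact: (fixed_equivalence hT h1 h2 h3 h4 (cb u uZ) hu' erefl erefl t E1 E2 E3 hB).
Qed.

(** The canonical part of a fixed block is the whole block; that of the first changed block is cut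
    out by comparing piece numbers, which are constant on the blocks of [T']. *)
Lemma derived_saturated (i : rstrip T) (j : cstrip T) Z (u v : 'I_m * 'I_n) :
  fixed_block A i j \/ first_changed A i j -> canonical_part A i j Z ->
  same_block T' u v -> u \in Z -> v \in Z.
Proof.
move=> h cZ suv uZ; have cb := canonical_part_block cZ uZ.
have vb : in_block i j v.
  have [s1 s2] := derived_same suv; have /in_blockP[u1 u2] := cb.
  by apply/in_blockP; rewrite -s1 -s2.
case: h => [fA|fc']; first by rewrite (fixed_part hT v fA cZ).
have [p [q [fc [dr [dc [e [E [h1 h2 h3 h4] hf]]]]]]] := derived_split dA.
have [ep eq] := first_changed_uniq fc fc'; subst T' i j.
move: cZ; rewrite /canonical_part.
case: ifPn hf => t; last by move=> _ [ds [a [_ EZ]]]; rewrite EZ inE.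
case=> lam sf [ds [lam' [sf' EZ]]].
have Ed := similarity_form_uniq sf sf'; subst ds.
move: uZ; rewrite EZ !inE vb cb /=.
have /in_blockP[u1 u2] := cb.
have [_] := refine_same_row hT h1 h2 h3 u1 suv.1.
have [_] := refine_same_col hT h1 h2 h3 u2 suv.2.
by rewrite split_row (split_col h3) -(h3 t) => -> ->.
Qed.

End Derived.
End Step.

(** * Zones along a chain of derived matrices *)

Section Zones.
Variables (C : numClosedFieldType) (m n : nat) (A : 'M[C]_(m, n)).
Variables (s : nat) (Ts : nat -> marking).
Hypothesis hT : marking_of m n (Ts 0%N).
Hypothesis hd : forall l, (l < s)%N -> derived (Ts l) A (Ts l.+1) A.
Hypothesis hs : stable (Ts s) A.
Implicit Types (Z : {set 'I_m * 'I_n}) (u v : 'I_m * 'I_n).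

Lemma chain_marking l : (l <= s)%N -> marking_of m n (Ts l).
Proof.
elim: l => // l IH ls; apply: derived_marking (hd ls).
exact/IH/ltnW.
Qed.

Lemma chain_same l l' u v : (l <= l')%N -> (l' <= s)%N ->
  same_block (Ts l') u v -> same_block (Ts l) u v.
Proof.
elim: l' => [|l' IH] ll ls; first by move: ll; rewrite leqn0 => /eqP->.
move: ll; rewrite leq_eqVlt => /orP[/eqP->//|ll].
move=> /(derived_same (chain_marking (ltnW ls)) (hd ls)); apply: IH => //.
exact: ltnW.
Qed.

Lemma block_of l u : (l <= s)%N ->
  exists (i : rstrip (Ts l)) (j : cstrip (Ts l)), in_block i j u.
Proof.
move=> /chain_marking h.
exists (Ordinal (reshape_indexP (row_lt h u.1))).
by exists (Ordinal (reshape_indexP (col_lt h u.2))); apply/in_blockP.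
Qed.

Lemma in_block_uniq T (i i' : rstrip T) (j j' : cstrip T) u :
  in_block i j u -> in_block i' j' u -> i = i' /\ j = j'.
Proof.
move=> /in_blockP[u1 u2] /in_blockP[v1 v2].
by split; apply: val_inj; rewrite /= -?u1 -?u2.
Qed.

Lemma same_in_block T (i : rstrip T) (j : cstrip T) u v :
  in_block i j u -> (same_block T u v <-> in_block i j v).
Proof.
move=> /in_blockP[u1 u2]; split=> [[h1 h2]|/in_blockP[v1 v2]].
  by apply/in_blockP; rewrite -h1 -h2.
by split; rewrite ?u1 ?u2.
Qed.

Definition eligible l (i : rstrip (Ts l)) (j : cstrip (Ts l)) : Prop :=
  l = s \/ ((l < s)%N /\
    exists (p : rstrip (Ts l)) (q : cstrip (Ts l)), first_changed A p q /\
      block_le (nat_of_ord i, nat_of_ord j) (nat_of_ord p, nat_of_ord q)).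

Lemma eligible_le l (i : rstrip (Ts l)) (j : cstrip (Ts l)) :
  eligible i j -> (l <= s)%N.
Proof. by case=> [->//|[/ltnW]]. Qed.

(** Among the blocks up to the first changed one, only that block itself changes; at depth [s] none
    does. *)
Lemma eligible_cases l (i : rstrip (Ts l)) (j : cstrip (Ts l)) :
  eligible i j -> fixed_block A i j \/ (l < s)%N /\ first_changed A i j.
Proof.
move=> el; have ls := eligible_le el; have hTl := chain_marking ls.
have [ch|nch] := pselect (changes (Ts l) A i j); last first.
  by left; apply: unchanged_fixed.
case: el => [E|[ll [p [q [fc le]]]]]; first by subst l; case: (hs ch).
right; split=> //; have [E1 E2] := block_le_anti (fc.2 _ _ ch) le.
by move: fc; rewrite (val_inj E1) (val_inj E2).
Qed.

Lemma eligible_part l (i : rstrip (Ts l)) (j : cstrip (Ts l)) :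
  eligible i j -> exists Z, canonical_part A i j Z.
Proof.
move=> el; have ls := eligible_le el; have hTl := chain_marking ls.
have [fA|[ll fc]] := eligible_cases el; first exact: fixed_canonical.
have [p [q [fc' [dr [dc [e [_ _ hf]]]]]]] := derived_split hTl (hd ll).
have [<- <-] := first_changed_uniq fc' fc; move: hf.
case: (boolP (tied (inl p) (inr q))) => t hf.
  case: hf => lam sf.
  by eexists; rewrite /canonical_part t; do 2 eexists; split; first exact: sf.
case: hf => ds [a [b [_ _ _ [al ef]]]].
eexists; rewrite /canonical_part (negPf t).
by do 2 eexists; split; first exact: ef.
Qed.

Lemma zone_saturated l l' (i : rstrip (Ts l)) (j : cstrip (Ts l)) Z u v :
  (l < l')%N -> (l' <= s)%N -> eligible i j -> canonical_part A i j Z ->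
  same_block (Ts l') u v -> u \in Z -> v \in Z.
Proof.
move=> ll ls el cZ /(chain_same ll ls) suv.
have ls' := leq_trans ll ls.
apply: (derived_saturated (chain_marking (ltnW ls')) (hd ls') _ cZ suv).
by have [|[]] := eligible_cases el; [left|right].
Qed.

(** Only the first refinement after depth [l] uses the shape of the block [(i, j)]; from then on
    being fixed is inherited. Hence [matching] at this one block suffices for [B]. *)
Lemma zone_fixed l l' (i : rstrip (Ts l)) (j : cstrip (Ts l))
    (i' : rstrip (Ts l')) (j' : cstrip (Ts l')) Z u (B : 'M[C]_(m, n)) :
  (l < l')%N -> (l' <= s)%N -> eligible i j -> canonical_part A i j Z ->
  matching A B i j -> u \in Z -> in_block i' j' u -> fixed_block B i' j'.
Proof.
move=> + + el cZ mAB uZ; elim: l' i' j' => // l' IH i' j' ll ls hu.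
have hTl := chain_marking (ltnW ls).
move: ll; rewrite ltnS leq_eqVlt => /orP[/eqP E|ll].
  subst l'; have [fA|[_ fc]] := eligible_cases el.
    have fB := (matching_fixed hTl cZ mAB).1 fA.
    exact: (derived_fixed hTl (hd ls) (canonical_part_block cZ uZ) hu fB).
  exact: (derived_part hTl (hd ls) fc cZ mAB uZ hu).
have [i1 [j1 hu1]] := block_of u (ltnW ls).
have := IH i1 j1 ll (ltnW ls) hu1.
exact: (derived_fixed hTl (hd ls) hu1 hu).
Qed.

Lemma zone_below_zone d Z : zone_below A s Ts d Z ->
  exists l (i : rstrip (Ts l)) (j : cstrip (Ts l)), (l < d)%N /\ zone A s i j Z.
Proof.
elim: d => //= d IH [/IH[l [i [j [ld z]]]]|[[i [j c]] nb]].
  by exists l, i, j; split; first exact: ltnW.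
by exists d, i, j.
Qed.

Lemma zone_zone_below l d (i : rstrip (Ts l)) (j : cstrip (Ts l)) Z :
  (l < d)%N -> zone A s i j Z -> zone_below A s Ts d Z.
Proof.
move=> + [zc nb]; elim: d => // d IH; rewrite ltnS leq_eqVlt => /orP[/eqP E|/IH h].
  by subst d; right; split=> //; exists i, j.
by left.
Qed.

Lemma candidate_eligible l (i : rstrip (Ts l)) (j : cstrip (Ts l)) Z :
  zone_candidate A s i j Z ->
  [/\ (l <= s)%N, eligible i j & canonical_part A i j Z].
Proof. by case=> el cZ _; split=> //; apply: (eligible_le el). Qed.

Lemma candidate_in_zone l (i : rstrip (Ts l)) (j : cstrip (Ts l)) Z :
  zone_candidate A s i j Z ->
  exists l' (i' : rstrip (Ts l')) (j' : cstrip (Ts l')) Z',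
    [/\ (l' <= l)%N, zone A s i' j' Z', Z \subset Z' & l' = l -> Z' = Z].
Proof.
move=> c; have [[Z' /zone_below_zone[l' [i' [j' [ll z]]]] sZ]|nb] :=
  pselect (exists2 Z', zone_below A s Ts l Z' & Z \subset Z').
  exists l', i', j', Z'; split=> //; first exact: ltnW.
  by move=> E; move: ll; rewrite E ltnn.
by exists l, i, j, Z; split.
Qed.

(** At depth [s] every block is fixed and equals its canonical part, so it is a candidate, and every
    candidate lies in a zone. *)
Lemma zone_cover u : exists l (i : rstrip (Ts l)) (j : cstrip (Ts l)) Z,
  zone A s i j Z /\ u \in Z.
Proof.
have [i [j hu]] := block_of u (leqnn s).
have el : eligible i j by left.
have fA : fixed_block A i j.
  by have [//|[]] := eligible_cases el; rewrite ltnn.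
have [Z cZ] := eligible_part el.
have uZ : u \in Z by rewrite (fixed_part (chain_marking (leqnn s)) u fA cZ).
have c : zone_candidate A s i j Z.
  by split=> //; apply/set0Pn; exists u.
have [l' [i' [j' [Z' [_ z sZ _]]]]] := candidate_in_zone c.
by exists l', i', j', Z'; split=> //; apply: (subsetP sZ).
Qed.

(** [Z'] lies in a single block of the later division, and [Z] is a union of such blocks; one common
    place already gives inclusion. *)
Lemma zone_depth_le l l' (i : rstrip (Ts l)) (j : cstrip (Ts l)) Z
    (i' : rstrip (Ts l')) (j' : cstrip (Ts l')) Z' u :
  zone A s i j Z -> zone_candidate A s i' j' Z' -> u \in Z -> u \in Z' ->
  (l < l')%N -> Z' \subset Z /\ ~ zone A s i' j' Z'.
Proof.
move=> z c' uZ uZ' ll.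
have [ls' el' cZ'] := candidate_eligible c'.
have [ls el cZ] := candidate_eligible z.1.
have sub : Z' \subset Z.
  apply/subsetP => v vZ'.
  apply: (zone_saturated ll ls' el cZ _ uZ).
  apply/(same_in_block _ (canonical_part_block cZ' uZ')).
  exact: (canonical_part_block cZ' vZ').
split=> // -[_]; apply; exists Z => //.
exact: (zone_zone_below ll z).
Qed.

(** The strips are compared as numbers because their types depend on the depths. *)
Lemma zone_uniq l l' (i : rstrip (Ts l)) (j : cstrip (Ts l)) Z
    (i' : rstrip (Ts l')) (j' : cstrip (Ts l')) Z' u :
  zone A s i j Z -> zone A s i' j' Z' -> u \in Z -> u \in Z' ->
  [/\ l = l', i = i' :> nat, j = j' :> nat & Z = Z'].
Proof.
move=> z z' uZ uZ'; case: (ltngtP l l') => [ll|ll|E].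
- by have [_] := zone_depth_le z z'.1 uZ uZ' ll.
- by have [_] := zone_depth_le z' z.1 uZ' uZ ll.
subst l'; have [ls el cZ] := candidate_eligible z.1.
have [ls' el' cZ'] := candidate_eligible z'.1.
have [E1 E2] := in_block_uniq (canonical_part_block cZ uZ)
  (canonical_part_block cZ' uZ').
subst i' j'; split=> //.
exact: (canonical_part_uniq cZ cZ').
Qed.

(** The zone covering [u] cannot have depth [l], since the canonical part of a block is unique. Nor
    can it be shallower: it would then contain the whole block, hence [Z], which would be no
    zone. *)
Lemma outside_zone_deeper l (i : rstrip (Ts l)) (j : cstrip (Ts l)) Z u :
  zone A s i j Z -> in_block i j u -> u \notin Z ->
  exists l' (i' : rstrip (Ts l')) (j' : cstrip (Ts l')) Z',
    [/\ (l < l')%N, zone A s i' j' Z' & u \in Z'].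
Proof.
move=> z hu nu; have [l' [i' [j' [Z' [z' uZ']]]]] := zone_cover u.
exists l', i', j', Z'; split=> //.
have [ls el cZ] := candidate_eligible z.1.
have [ls' el' cZ'] := candidate_eligible z'.1.
case: (ltngtP l l') => // [ll|E].
  case: z => [[_ _ /set0Pn[v vZ]] []]; exists Z'.
    exact: (zone_zone_below ll z').
  apply/subsetP => w wZ; apply: (zone_saturated ll ls el' cZ' _ uZ').
  apply/(same_in_block _ hu); exact: (canonical_part_block cZ wZ).
subst l'; have [E1 E2] := in_block_uniq hu (canonical_part_block cZ' uZ').
by subst i' j'; move: nu; rewrite (canonical_part_uniq cZ cZ') uZ'.
Qed.

End Zones.

(** * Filling a scheme *)

Section Filling.
Variables (C : numClosedFieldType) (m n : nat) (S : scheme m n).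
Implicit Types (Z : {set 'I_m * 'I_n}) (u v : 'I_m * 'I_n) (B : 'M[C]_(m, n)).
Implicit Types (P Q : 'M[option C]_(m, n)).

Lemma star_in_zone Z a b lo hi x : stars_under_stair S Z a b lo hi ->
  (lo <= x <= hi)%N ->
  exists (i : 'I_m) (j : 'I_n), [/\ i = (a + x)%N :> nat, j = (b + x)%N :> nat,
    (i, j) \in Z & symb S i j = Star].
Proof.
move=> [_ ha hb [i0 h]] /andP[lx xh].
have la : (a + x < m)%N by lia.
have lb : (b + x < n)%N by lia.
exists (Ordinal la), (Ordinal lb).
have [] := (h (Ordinal la) (Ordinal lb)).2; first by exists x; rewrite lx xh.
by [].
Qed.

(** The form that [zone_filled] takes for a matrix without open places. *)
Definition fillable Z B : Prop :=
  [/\ forall i j, (i, j) \in Z -> admissible_value (symb S i j) (B i j),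
      forall (i i' : 'I_m) (j j' : 'I_n),
        i' = i.+1 :> nat -> j' = j.+1 :> nat ->
        (i, j) \in Z -> (i', j') \in Z ->
        symb S i j = Circle -> symb S i' j' = Circle ->
        (joined S (i, j) (i', j') -> B i j = B i' j') /\
        (~ joined S (i, j) (i', j') -> B i' j' < B i j),
      forall alpha beta k, stars_under_stair S Z alpha beta 0 k ->
        forall x, (x <= k)%N ->
          entry B (alpha + x) (beta + x) = entry B alpha beta &
      forall alpha beta k t,
        stars_under_stair S Z alpha beta 0 k ->
        stars_under_stair S Z alpha beta k.+1 t ->
        let W := window B alpha (beta + k.+1) k.+1 (t - k) in
        clex_le (entry B (alpha + t) (beta + t)) (entry B alpha beta) /\
        (~~ row_free W^T ->
         clex_lt (entry B (alpha + t) (beta + t)) (entry B alpha beta))].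

Lemma fillableE Z B : zone_filled S Z (map_mx Some B) <-> fillable Z B.
Proof.
rewrite /zone_filled.
have -> : map_mx (odflt 0) (map_mx Some B) = B.
  by apply/matrixP => i j; rewrite !mxE.
split=> -[h1 h2 h3 h4]; split=> // i j ij; have := h1 i j ij.
  by case=> z []; rewrite mxE => -[->].
by move=> h; exists (B i j); rewrite mxE.
Qed.

Definition all_fillable B := forall d Z, Z \in zones S d -> fillable Z B.

Variable D : nat.
Hypothesis zones_bounded : forall d, (D <= d)%N -> zones S d = set0.
Hypothesis zones_cover : forall u, exists d Z, Z \in zones S d /\ u \in Z.
Hypothesis zones_disjoint : forall d d' Z Z' u,
  Z \in zones S d -> Z' \in zones S d' -> u \in Z -> u \in Z' -> d = d'.
Hypothesis stairs_deeper :
  forall (d : nat) (Z : {set 'I_m * 'I_n}) (alpha beta k t : nat),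
     Z \in zones S d ->
     stars_under_stair S Z alpha beta 0 k ->
     stars_under_stair S Z alpha beta k.+1 t ->
     forall (i : 'I_m) (j : 'I_n),
       (alpha <= i <= alpha + k)%N -> (beta + k.+1 <= j <= beta + t)%N ->
       exists d' Z', [/\ (d < d')%N, Z' \in zones S d' & (i, j) \in Z'].

(* The conditions on a zone of depth d involve only entries in zones of depth at
   least d, so they may be checked on the completely filled matrix. *)
Lemma zone_filled_agree d Z P Q : Z \in zones S d ->
  (forall d' Z' u, (d <= d')%N -> Z' \in zones S d' -> u \in Z' ->
     P u.1 u.2 = Q u.1 u.2) ->
  zone_filled S Z P -> zone_filled S Z Q.
Proof.
move=> dZ eqPQ; have inZ i j : (i, j) \in Z -> P i j = Q i j.
  exact: (eqPQ d Z (i, j) (leqnn d) dZ).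
have starE a b lo hi x : stars_under_stair S Z a b lo hi -> (lo <= x <= hi)%N ->
    entry (map_mx (odflt 0) P) (a + x) (b + x) =
    entry (map_mx (odflt 0) Q) (a + x) (b + x).
  move=> st /(star_in_zone st)[i [j [<- <- ij _]]].
  by rewrite !entryE !mxE inZ.
case=> h1 h2 h3 h4; split.
- by move=> i j ij; rewrite -inZ //; apply: h1.
- move=> i i' j j' e1 e2 z1 z2 c1 c2; rewrite !mxE -!inZ //.
  by have := h2 i i' j j' e1 e2 z1 z2 c1 c2; rewrite !mxE.
- move=> a b k st x xk; rewrite -(starE _ _ _ _ _ st) //.
  have := starE _ _ _ _ 0%N st; rewrite !addn0 => <- //.
  exact: (h3 a b k st x xk).
move=> a b k t st st'; have := h4 a b k t st st'.
have [kt _ _ _] := st'.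
have -> : window (map_mx (odflt 0) P) a (b + k.+1) k.+1 (t - k) =
          window (map_mx (odflt 0) Q) a (b + k.+1) k.+1 (t - k).
  apply/matrixP => x y; rewrite !mxE.
  have [_ am bn _] := st'; have lx := ltn_ord x; have ly := ltn_ord y.
  have la : (a + x < m)%N by lia.
  have lb : (b + k.+1 + y < n)%N by lia.
  rewrite -[(a + x)%N]/(val (Ordinal la)) -[(_ + y)%N]/(val (Ordinal lb)) !entryE.
  have [||d' [Z' [dd zZ' uZ']]] := stairs_deeper dZ st st'
    (i := Ordinal la) (j := Ordinal lb); rewrite /=; [lia|lia|].
  by rewrite !mxE (eqPQ d' Z' (Ordinal la, Ordinal lb) (ltnW dd) zZ' uZ').
rewrite (starE _ _ _ _ _ st') ?leqnn ?andbT //.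
by have := starE _ _ _ _ 0%N st; rewrite !addn0 => ->.
Qed.

Lemma filled_zone_filled d Q : filled S d Q ->
  forall d' Z, (d <= d')%N -> Z \in zones S d' -> zone_filled S Z Q.
Proof.
elim=> {d Q} [d hd d' Z dd|d P Q _ IH out zf d' Z].
  by rewrite hd // inE.
rewrite leq_eqVlt => /orP[/eqP <-|dd] hZ; first exact: zf.
apply: (zone_filled_agree hZ) (IH _ _ dd hZ) => d1 Z1 [i j] dd1 hZ1 u1.
(* A place in a zone of depth greater than [d] is in no zone of depth [d], so the step at depth [d]
   leaves it as it was. *)
symmetry; apply: out => Z2 hZ2; apply/negP => u2.
have := zones_disjoint hZ1 hZ2 u1 u2; lia.
Qed.

Lemma constructedE B :
  constructed S B <-> all_fillable B.
Proof.
split=> [fB d Z hZ|h].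
  by apply/fillableE; apply: (filled_zone_filled fB (leq0n d) hZ).
pose reached d (u : 'I_m * 'I_n) :=
  `[< exists d' Z, [/\ (d <= d')%N, Z \in zones S d' & u \in Z] >].
(* The stage at which exactly the zones of depth at least [d] have received their entries from
   [B]. *)
pose Q d : 'M[option C]_(m, n) :=
  \matrix_(i, j) (if reached d (i, j) then Some (B i j) else None).
have QB : map_mx Some B = Q 0%N.
  apply/matrixP => i j; rewrite !mxE; case: ifPn => // /asboolPn [].
  by have [d [Z [h1 h2]]] := zones_cover (i, j); exists d, Z.
rewrite /constructed QB.
have : forall k, filled S (D - k) (Q (D - k)%N).
  elim=> [|k IH].
    rewrite subn0; have -> : Q D = const_mx None; last first.
      exact: (@filled_start C m n S D zones_bounded).
    apply/matrixP => i j; rewrite !mxE; case: ifPn => // /asboolP[d [Z [dd]]].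
    by rewrite zones_bounded // inE.
  (* The depth [D - k] descends to 0 and stays there, the subtraction being truncated. *)
  case: (leqP D k) => Dk; first by have -> : (D - k.+1 = D - k)%N by lia.
  have E : (D - k = (D - k.+1).+1)%N by lia.
  rewrite E in IH; apply: filled_step IH _ _.
    move=> i j nij; rewrite !mxE; congr (if _ then _ else _).
    apply/asboolP/asboolP => -[d [Z [dd hZ u]]]; exists d, Z;
      split=> //; last by lia.
    rewrite ltn_neqAle dd andbT; apply/eqP => E'; rewrite -E' in hZ.
    by have := nij Z hZ; rewrite u.
  move=> Z hZ; apply: (zone_filled_agree hZ) ((fillableE Z B).2 (h _ _ hZ)).
  move=> d' Z' [i j] dd hZ' u; rewrite !mxE; case: ifPn => // /asboolPn [].
  by exists d', Z'.
by move/(_ D); rewrite subnn.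
Qed.

End Filling.

(** * The filling conditions on a single zone *)

Section Scheme.
Variables (C : numClosedFieldType) (m n : nat) (A : 'M[C]_(m, n)).
Variables (s : nat) (Ts : nat -> marking).
Hypothesis hT : marking_of m n (Ts 0%N).
Hypothesis hd : forall l, (l < s)%N -> derived (Ts l) A (Ts l.+1) A.
Hypothesis hs : stable (Ts s) A.
Variable S : scheme m n.
Hypothesis zonesE : forall d Z, Z \in zones S d <->
  exists (i : rstrip (Ts d)) (j : cstrip (Ts d)), zone A s i j Z.
Hypothesis starE : forall u, symb S u.1 u.2 = Star <->
  exists d (i : rstrip (Ts d)) (j : cstrip (Ts d)) Z,
    [/\ zone A s i j Z, tied (inl i) (inr j), u \in Z &
        on_block_diagonal (Ts d) u].
Hypothesis circleE : forall u, symb S u.1 u.2 = Circle <->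
  exists d (i : rstrip (Ts d)) (j : cstrip (Ts d)) Z,
    [/\ zone A s i j Z, ~~ tied (inl i) (inr j), u \in Z &
        A u.1 u.2 != 0].
Hypothesis joinedE : forall u v, joined S u v <-> u <> v /\
  [/\ symb S u.1 u.2 = Circle, symb S v.1 v.2 = Circle,
      A u.1 u.2 = A v.1 v.2 &
      exists d Z, [/\ Z \in zones S d, u \in Z & v \in Z]].
Implicit Types (Z : {set 'I_m * 'I_n}) (u : 'I_m * 'I_n).

Section Zone.
Variables (d : nat) (i : rstrip (Ts d)) (j : cstrip (Ts d)) (Z : {set 'I_m * 'I_n}).
Hypothesis zZ : zone A s i j Z.

Let zu (l : nat) (i' : rstrip (Ts l)) (j' : cstrip (Ts l)) Z' u :
    zone A s i' j' Z' -> u \in Z -> u \in Z' ->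
  [/\ d = l, i = i' :> nat, j = j' :> nat & Z = Z'].
Proof. exact: (zone_uniq hT hd hs zZ). Qed.

Lemma star_zone u : u \in Z ->
  (symb S u.1 u.2 = Star <-> tied (inl i) (inr j) /\ on_block_diagonal (Ts d) u).
Proof.
move=> uZ; rewrite starE; split=> [[l [i' [j' [Z' [z' t u' od]]]]]|[t od]].
  have [E] := zu z' uZ u'; subst l => /val_inj E1 /val_inj E2 _.
  by subst i' j'.
by exists d, i, j, Z.
Qed.

Lemma circle_zone u : u \in Z ->
  (symb S u.1 u.2 = Circle <-> ~~ tied (inl i) (inr j) /\ A u.1 u.2 != 0).
Proof.
move=> uZ; rewrite circleE; split=> [[l [i' [j' [Z' [z' t u' od]]]]]|[t od]].
  have [E] := zu z' uZ u'; subst l => /val_inj E1 /val_inj E2 _.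
  by subst i' j'.
by exists d, i, j, Z.
Qed.

Lemma joined_zone u v : u \in Z -> v \in Z -> symb S u.1 u.2 = Circle ->
  symb S v.1 v.2 = Circle -> u <> v -> (joined S u v <-> A u.1 u.2 = A v.1 v.2).
Proof.
move=> uZ vZ cu cv uv; rewrite joinedE; split=> [[_ []]//|e].
by do 2 split=> //; exists d, Z; split=> //; apply/zonesE; exists i, j.
Qed.

Let hTd : marking_of m n (Ts d).
Proof.
have [ls _ _] := candidate_eligible zZ.1.
exact: (chain_marking hT hd ls).
Qed.

Local Notation si := (start (rstrips (Ts d)) i).
Local Notation sj := (start (cstrips (Ts d)) j).

Lemma in_block_entry (B : 'M[C]_(m, n)) u : in_block i j u ->
  B u.1 u.2 = entry B (si + off (rstrips (Ts d)) u.1)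
                      (sj + off (cstrips (Ts d)) u.2).
Proof.
by move=> /in_blockP[/(row_in hTd)[<- _] /(col_in hTd)[<- _]]; rewrite entryE.
Qed.

Section Similarity.
Variables (ds : seq nat) (lam : seq C).
Hypothesis tij : tied (inl i) (inr j).
Hypothesis sf : similarity_form ds lam (blk (Ts d) A i j).

Let pds : all (ltn 0) ds.
Proof. by have [[]] := (similarity_blkE hTd _ _ _ _ _).1 sf. Qed.
Let e1 : sumn ds = nth 0%N (rstrips (Ts d)) i.
Proof. by have [_ []] := (similarity_blkE hTd _ _ _ _ _).1 sf. Qed.
Let e2 : sumn ds = nth 0%N (cstrips (Ts d)) j.
Proof. by have [_ []] := (similarity_blkE hTd _ _ _ _ _).1 sf. Qed.

Lemma similarity_zone u : (u \in Z) = in_block i j u &&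
  (idx ds (off (cstrips (Ts d)) u.2) <= idx ds (off (rstrips (Ts d)) u.1))%N.
Proof.
have [_ _ cZ] := candidate_eligible zZ.1.
rewrite /canonical_part tij in cZ; case: cZ => ds' [lam' [sf' ->]].
by rewrite inE (similarity_form_uniq sf sf').
Qed.

(** Each row of the block contains its own diagonal place in [Z]. If two rows meet [Z] in the same
    columns, each therefore reaches the diagonal strip of the other, and the two strip numbers
    agree. *)
Lemma stair_chart (r : 'I_m) (c : 'I_n) (r0 : 'I_m) :
  idx (rstrips (Ts d)) r0 = i ->
  let v := idx ds (off (rstrips (Ts d)) r0) in
  [/\ (r, c) \in Z, symb S r c = Star & zone_row Z r = zone_row Z r0] <->
  exists o, [/\ (o < nth 0 ds v)%N, r = (si + (start ds v + o))%N :> nat &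
    c = (sj + (start ds v + o))%N :> nat].
Proof.
move=> hr0 v.
have diag (r1 : 'I_m) : idx (rstrips (Ts d)) r1 = i ->
  exists c1 : 'I_n, (r1, c1) \in Z /\
    off (cstrips (Ts d)) c1 = off (rstrips (Ts d)) r1.
  move=> h1; have [_ l1] := row_in hTd h1; rewrite -e1 e2 in l1.
  have [c1 ec1] := col_at hTd l1; exists c1; rewrite ec1 off_start //.
  by rewrite similarity_zone /in_block /= h1 ec1 idx_start ?off_start // !eqxx /=.
have row_le (r1 r2 : 'I_m) : idx (rstrips (Ts d)) r1 = i ->
  zone_row Z r1 = zone_row Z r2 ->
  (idx ds (off (rstrips (Ts d)) r1) <= idx ds (off (rstrips (Ts d)) r2))%N.
  move=> h1 /setP; have [c1 [z1 oc1]] := diag r1 h1.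
  move=> /(_ c1); rewrite !inE z1 => /esym.
  by rewrite similarity_zone /= oc1 => /andP[].
split=> [[zr st er]|[o [lo er ec]]].
  have := zr; rewrite similarity_zone => /andP[/in_blockP[/= hr hc] _].
  have /eqP od := ((star_zone zr).1 st).2; rewrite /= in od.
  have Ev : idx ds (off (rstrips (Ts d)) r) = v.
    by apply/eqP; rewrite eqn_leq (row_le _ _ hr er) (row_le _ _ hr0 (esym er)).
  have [ex lx] := row_in hTd hr; have [ey _] := col_in hTd hc.
  exists (off ds (off (rstrips (Ts d)) r)).
  rewrite -Ev idx_off reshape_offsetP ?e1 //; split=> //.
  by rewrite od.
have lo' := start_sumn lo; have lr := lo'; have lc := lo'.
rewrite e1 in lr; rewrite e2 in lc.
have hr : idx (rstrips (Ts d)) r = i by rewrite er idx_start.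
have or : off (rstrips (Ts d)) r = (start ds v + o)%N by rewrite er off_start.
have hc : idx (cstrips (Ts d)) c = j by rewrite ec idx_start.
have oc : off (cstrips (Ts d)) c = (start ds v + o)%N by rewrite ec off_start.
have zr : (r, c) \in Z.
  by rewrite similarity_zone /in_block /= hr hc or oc !eqxx /=.
split=> //.
  by apply/(star_zone zr); split=> //; rewrite /on_block_diagonal /= or oc.
apply/setP=> c'; rewrite !inE !similarity_zone /in_block /= hr hr0 or.
by rewrite idx_start.
Qed.

Lemma stars_under_stairP a b lo hi : stars_under_stair S Z a b lo hi <->
  exists v, [/\ (v < size ds)%N, (a + lo = si + start ds v)%N,
    (b + lo = sj + start ds v)%N, (lo <= hi)%N & (hi - lo).+1 = nth 0%N ds v].
Proof.
split=> [st|[v [hv ea eb lh eh]]].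
  have [lh am bn [i0 h]] := st.
  have [|r [c [er ec rcZ rcS]]] := star_in_zone st (x := lo); first by rewrite leqnn.
  have /h[_ _ er0] : exists x, [/\ (lo <= x <= hi)%N, r = (a + x)%N :> nat &
      c = (b + x)%N :> nat].
    by exists lo; rewrite leqnn.
  have hr : idx (rstrips (Ts d)) r = i.
    by move: rcZ; rewrite similarity_zone => /andP[/in_blockP[]].
  set v := idx ds (off (rstrips (Ts d)) r).
  have ch (r' : 'I_m) (c' : 'I_n) :
     (exists x, [/\ (lo <= x <= hi)%N, r' = (a + x)%N :> nat &
       c' = (b + x)%N :> nat]) <->
     (exists o, [/\ (o < nth 0 ds v)%N, r' = (si + (start ds v + o))%N :> nat &
       c' = (sj + (start ds v + o))%N :> nat]).
    by rewrite -(stair_chart r' c' hr) -h er0.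
  have [_ lr] := row_in hTd hr; rewrite -e1 in lr.
  have hv : (v < size ds)%N := reshape_indexP lr.
  have n0 := nth_pos pds hv.
  (* The two parametrizations of the same stars, by [x] and by the offset [o], differ by a shift;
     comparing the end points of both ranges determines it. *)
  have at_off o : (o < nth 0 ds v)%N -> exists x, [/\ (lo <= x <= hi)%N,
      (si + (start ds v + o))%N = (a + x)%N & (sj + (start ds v + o))%N = (b + x)%N].
    move=> lo'; have lr' := start_sumn lo'; have lc' := lr'.
    rewrite e1 in lr'; rewrite e2 in lc'.
    have [r' er'] := row_at hTd lr'; have [c' ec'] := col_at hTd lc'.
    have [|x [hx h1 h2]] := (ch r' c').2; first by exists o.
    by exists x; rewrite -er' -ec'.
  have at_x x : (lo <= x <= hi)%N -> exists o, [/\ (o < nth 0 ds v)%N,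
      (a + x)%N = (si + (start ds v + o))%N & (b + x)%N = (sj + (start ds v + o))%N].
    move=> hx; have [r' [c' [er' ec' _ _]]] := star_in_zone st hx.
    have [|o [ho h1 h2]] := (ch r' c').1; first by exists x.
    by exists o; rewrite -er' -ec'.
  have [|o1 [ho1 h1 h1']] := at_x lo; first by rewrite leqnn.
  have [|o2 [ho2 h2 h2']] := at_x hi; first by rewrite leqnn andbT.
  have [x1 [/andP[hx1 hx1'] h3 h3']] := at_off 0%N n0.
  have [|x2 [/andP[hx2 hx2'] h4 h4']] := at_off (nth 0%N ds v).-1; first by lia.
  by exists v; split=> //; lia.
have n0 := nth_pos pds hv.
have lt0 : (start ds v < sumn ds)%N by have := start_sumn n0; rewrite addn0.
have lt1 := start_nth_le ds v.
have lr0 := lt0; rewrite e1 in lr0.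
have [r0 er0] := row_at hTd lr0.
have := start_nth_le (rstrips (Ts d)) i; have := start_nth_le (cstrips (Ts d)) j.
have [-> -> _] := hTd; rewrite -e1 -e2 => bn bm.
split=> //; [lia|lia|exists r0 => r c].
have hr0 : idx (rstrips (Ts d)) r0 = i by rewrite er0 idx_start.
have Ev : idx ds (off (rstrips (Ts d)) r0) = v.
  by rewrite er0 off_start // -[start ds v]addn0 idx_start.
have -> := stair_chart r c hr0; rewrite /= Ev.
split=> [[o [ho -> ->]]|[x [/andP[hx hx'] -> ->]]].
  by exists (lo + o)%N; split; lia.
by exists (x - lo)%N; split; lia.
Qed.

Lemma next_stair a b k t : stars_under_stair S Z a b 0 k ->
  stars_under_stair S Z a b k.+1 t ->
  exists v, [/\ (v.+1 < size ds)%N, a = (si + start ds v)%N,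
    b = (sj + start ds v)%N, k.+1 = nth 0%N ds v & 
    [/\ (t - k)%N = nth 0%N ds v.+1, (k < t)%N,
     (a + t = si + (start ds v.+1 + (t - k).-1))%N &
     (b + t = sj + (start ds v.+1 + (t - k).-1))%N]].
Proof.
move=> /stars_under_stairP[v [hv]]; rewrite !addn0 subn0 => ea eb _ ek.
move=> /stars_under_stairP[v' [hv' ea' eb' lt ek']].
have n0 := nth_pos pds hv; have n1 := nth_pos pds hv'.
have sv := startS ds v.
have Es : start ds v' = start ds v.+1 by lia.
(* The second run of stars begins where strip [v] ends, and strips of positive size are determined
   by their starts. *)
have h1 : (v' <= v.+1)%N by apply: (start_leq pds hv'); rewrite Es.
have h2 : (v < v')%N.
  by rewrite ltnNge; apply/negP => /(leq_start ds); lia.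
have E : v' = v.+1 by lia.
by subst v'; exists v; split=> //; split; lia.
Qed.

(** The window is the block [F_{v,v+1}] of (2). It lies in the block [(i, j)] but above the
    staircase. *)
Lemma window_deeper a b k t (r : 'I_m) (c : 'I_n) :
  stars_under_stair S Z a b 0 k -> stars_under_stair S Z a b k.+1 t ->
  (a <= r <= a + k)%N -> (b + k.+1 <= c <= b + t)%N ->
  exists d' Z', [/\ (d < d')%N, Z' \in zones S d' & (r, c) \in Z'].
Proof.
move=> st st' hr hc.
have [v [hv ea eb ek [et kt _ _]]] := next_stair st st'.
have sv := startS ds v.
pose o1 := (r - a)%N; pose o2 := (c - (b + k.+1))%N.
have lo1 : (o1 < nth 0 ds v)%N by rewrite /o1; lia.
have lo2 : (o2 < nth 0 ds v.+1)%N by rewrite /o2; lia.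
have l1 := start_sumn lo1; have l2 := start_sumn lo2.
rewrite e1 in l1; rewrite e2 in l2.
have er : r = (si + (start ds v + o1))%N :> nat by rewrite /o1; lia.
have ec : c = (sj + (start ds v.+1 + o2))%N :> nat by rewrite /o2; lia.
have inb : in_block i j (r, c) by rewrite /in_block /= er ec !idx_start // !eqxx.
have nz : (r, c) \notin Z.
  rewrite similarity_zone inb /= er ec !off_start // !idx_start //; lia.
have [d' [i' [j' [Z' [dd z' uZ']]]]] := outside_zone_deeper hT hd hs zZ inb nz.
by exists d', Z'; split=> //; apply/zonesE; exists i', j'.
Qed.

Lemma fillable_similarity (B : 'M[C]_(m, n)) :
  fillable S Z B <-> exists lam', similarity_form ds lam' (blk (Ts d) B i j).
Proof.
have pt u : u \in Z -> ~~ on_block_diagonal (Ts d) u -> symb S u.1 u.2 = Point.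
  move=> uZ od; case E : (symb S u.1 u.2) => //.
    by move/(star_zone uZ): E => [_]; rewrite (negPf od).
  by move/(circle_zone uZ): E => [/negP[]].
have ncirc u : u \in Z -> symb S u.1 u.2 <> Circle.
  by move=> uZ /(circle_zone uZ)[/negP[]].
(* The upper end of a run of stars is included, hence the predecessor of the size. *)
have stair v : (v < size ds)%N -> stars_under_stair S Z (si + start ds v)
    (sj + start ds v) 0 (nth 0%N ds v).-1.
  move=> hv; have n0 := nth_pos pds hv.
  by apply/stars_under_stairP; exists v; split=> //; lia.
have stair' v : (v.+1 < size ds)%N -> stars_under_stair S Z (si + start ds v)
    (sj + start ds v) (nth 0%N ds v).-1.+1 ((nth 0%N ds v).-1 + nth 0%N ds v.+1).
  move=> hv; have n0 := nth_pos pds (ltnW hv); have n1 := nth_pos pds hv.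
  by apply/stars_under_stairP; exists v.+1; rewrite startS; split=> //; lia.
split=> [[h1 h2 h3 h4]|[lam' sB]].
  (* The eigenvalue of strip [v] is read off at its first star; by the third condition every star of
     the strip has this value, in particular the last one, where the fourth condition compares. *)
  pose l v := entry B (si + start ds v) (sj + start ds v).
  have lE v x : (v < size ds)%N -> (x < nth 0 ds v)%N ->
      entry B (si + (start ds v + x)) (sj + (start ds v + x)) = l v.
    by move=> hv hx; rewrite !addnA; apply: (h3 _ _ _ (stair v hv)); lia.
  have lamE v : (v < size ds)%N -> nth 0 (mkseq l (size ds)) v = l v.
    exact: nth_mkseq.
  have step v : (v.+1 < size ds)%N -> clex_le (l v.+1) (l v) /\
      (~~ row_free (window B (si + start ds v) (sj + start ds v.+1)
          (nth 0%N ds v) (nth 0%N ds v.+1))^T -> clex_lt (l v.+1) (l v)).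
    move=> hv; have n0 := nth_pos pds (ltnW hv); have n1 := nth_pos pds hv.
    have := h4 _ _ _ _ (stair v (ltnW hv)) (stair' v hv).
    have E1 : ((nth 0 ds v).-1.+1 = nth 0 ds v)%N by lia.
    have E2 : ((nth 0 ds v).-1 + nth 0 ds v.+1 - (nth 0 ds v).-1
               = nth 0 ds v.+1)%N by lia.
    have E4 : (sj + start ds v + nth 0 ds v = sj + start ds v.+1)%N.
      by rewrite startS addnA.
    rewrite E1 E2 E4 /=.
    have lt : ((nth 0 ds v.+1).-1 < nth 0 ds v.+1)%N by lia.
    have E3 x : (x + start ds v + ((nth 0 ds v).-1 + nth 0 ds v.+1) =
       x + (start ds v.+1 + (nth 0 ds v.+1).-1))%N by rewrite startS; lia.
    by rewrite !E3 lE.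
  exists (mkseq l (size ds)); apply/(similarity_blkE hTd); split=> //.
  - by rewrite size_mkseq.
  - apply/(sortedP 0) => v; rewrite size_mkseq => hv.
    by rewrite !lamE ?(ltnW hv) //; have [] := step v hv.
  - move=> u hu le; have uZ : u \in Z by rewrite similarity_zone hu.
    case: ifPn => od; last first.
      by have := h1 u.1 u.2; rewrite -surjective_pairing pt //; apply.
    have /in_blockP[/(row_in hTd)[_ lr] _] := hu; rewrite -e1 in lr.
    rewrite lamE ?reshape_indexP // (in_block_entry B hu) -(eqP od).
    by rewrite -{1 2}(idx_off ds (off _ u.1)) lE ?reshape_indexP ?reshape_offsetP.
  (* Dependent columns would force a strict inequality between eigenvalues that are equal by [E]. *)
  move=> v hv; rewrite !lamE ?(ltnW hv) // => E.
  apply: contraT => nf; have [_ /(_ nf)] := step v hv.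
  by rewrite /clex_lt E eqxx.
have [[sl _] _ srt hB hrf] := (similarity_blkE hTd _ _ _ _ _).1 sB.
have dE v x : (v < size ds)%N -> (x < nth 0 ds v)%N ->
    entry B (si + (start ds v + x)) (sj + (start ds v + x)) = nth 0 lam' v.
  move=> hv hx; have l1 := start_sumn hx; have l2 := l1.
  rewrite e1 in l1; rewrite e2 in l2.
  have [u [hu o1 o2]] := in_block_at hTd l1 l2.
  have := in_block_entry B hu; rewrite o1 o2 => <-.
  by rewrite hB // /on_block_diagonal o1 o2 ?eqxx ?idx_start.
split.
- move=> r c rc; have := rc; rewrite similarity_zone => /andP[hu le].
  case E : (symb S r c) => //; first by case: (ncirc _ rc).
  rewrite /= (hB (r, c)) //; case: ifP => // od.
  by have := (star_zone rc).2 (conj tij od); rewrite /= E.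
- by move=> r r' c c' _ _ rc _ /(ncirc _ rc).
- move=> a b k /stars_under_stairP[v [hv]]; rewrite !addn0 subn0 => -> -> _ ek x xk.
  have n0 := nth_pos pds hv.
  have -> : entry B (si + start ds v) (sj + start ds v) = nth 0 lam' v.
    by rewrite -(dE v 0%N) // addn0.
  by rewrite -!addnA dE //; lia.
move=> a b k t st st' W.
have [v [hv ea eb ek [et kt Ea Eb]]] := next_stair st st'.
have n0 := nth_pos pds (ltnW hv); have n1 := nth_pos pds hv.
rewrite Ea Eb dE //; last by lia.
have -> : entry B a b = nth 0 lam' v.
  by rewrite -(dE v 0%N) ?(ltnW hv) // addn0 ea eb.
have le : clex_le (nth 0 lam' v.+1) (nth 0 lam' v).
  by have /(_ v) := elimT (sortedP 0) srt; rewrite sl => /(_ hv).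
split=> // nf; rewrite /clex_lt le andbT; apply/eqP => E.
by case/negP: nf; rewrite /W ea eb et ek -addnA -startS; apply: hrf.
Qed.

End Similarity.
Section Equivalence.
Variables (ds : seq nat) (al : seq C).
Hypothesis nt : ~~ tied (inl i) (inr j).
Hypothesis ef : equivalence_form ds al (blk (Ts d) A i j).

Let pds : all (ltn 0) ds.
Proof. by have [_] := (equivalence_blkE hTd _ _ _ _ _).1 ef. Qed.
Let le : (sumn ds <= minn (nth 0 (rstrips (Ts d)) i) (nth 0 (cstrips (Ts d)) j))%N.
Proof. by have [_] := (equivalence_blkE hTd _ _ _ _ _).1 ef. Qed.

Lemma equivalence_zone u : (u \in Z) = in_block i j u.
Proof.
have [_ _ cZ] := candidate_eligible zZ.1.
rewrite /canonical_part (negPf nt) in cZ; case: cZ => ds' [lam' [_ ->]].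
by rewrite inE.
Qed.

Local Notation on_diagonal u :=
  (on_block_diagonal (Ts d) u && (off (rstrips (Ts d)) u.1 < sumn ds)%N).

Lemma circle_equivalence u : u \in Z ->
  (symb S u.1 u.2 = Circle <-> on_diagonal u).
Proof.
move=> uZ; rewrite (circle_zone uZ).
rewrite -(equivalence_neq0 hTd ef) -?equivalence_zone //.
by split=> [[]|].
Qed.

Lemma joined_equivalence (u v : 'I_m * 'I_n) : u \in Z -> v \in Z ->
  symb S u.1 u.2 = Circle -> symb S v.1 v.2 = Circle -> u <> v ->
  (joined S u v <->
   idx ds (off (rstrips (Ts d)) u.1) = idx ds (off (rstrips (Ts d)) v.1)).
Proof.
move=> uZ vZ cu cv uv; rewrite (joined_zone uZ vZ cu cv uv).
apply: (equivalence_eq hTd ef); rewrite -?equivalence_zone //.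
  exact/circle_equivalence.
exact/circle_equivalence.
Qed.

Lemma fillable_equivalence (B : 'M[C]_(m, n)) :
  fillable S Z B <-> exists al', equivalence_form ds al' (blk (Ts d) B i j).
Proof.
have nstar u : u \in Z -> symb S u.1 u.2 <> Star.
  by move=> uZ /(star_zone uZ)[t]; move: nt; rewrite t.
have diag_at o : (o < sumn ds)%N -> exists u : 'I_m * 'I_n,
  [/\ u \in Z, symb S u.1 u.2 = Circle, off (rstrips (Ts d)) u.1 = o,
      u.1 = (si + o)%N :> nat & u.2 = (sj + o)%N :> nat].
  move=> ho; have l1 : (o < nth 0 (rstrips (Ts d)) i)%N by lia.
  have l2 : (o < nth 0 (cstrips (Ts d)) j)%N by lia.
  have [u [hu o1 o2]] := in_block_at hTd l1 l2.
  have uZ : u \in Z by rewrite equivalence_zone.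
  exists u; have /in_blockP[/(row_in hTd)[q1 _] /(col_in hTd)[q2 _]] := hu.
  split=> //; [|by rewrite {1}q1 o1|by rewrite {1}q2 o2].
  by apply/(circle_equivalence uZ); rewrite /on_block_diagonal o1 o2 eqxx.
have pair_neq (u v : 'I_m * 'I_n) : v.1 = u.1.+1 :> nat -> u <> v.
  by move=> e E; move: e; rewrite E; lia.
split=> [[h1 h2 _ _]|[al' eB]].
  (* The filling condition compares neighbouring diagonal entries only. They agree inside a summand
     and drop at its end, and the values [a_v] are taken at the starts of the summands. *)
  pose b o := entry B (si + o) (sj + o).
  have bE u o : u.1 = (si + o)%N :> nat -> u.2 = (sj + o)%N :> nat ->
      B u.1 u.2 = b o.
    by move=> e1 e2; rewrite /b -e1 -e2 entryE.
  have pos o : (o < sumn ds)%N -> 0 < b o.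
    move=> /diag_at[u [uZ cu _ eu1 eu2]]; rewrite -(bE u) //.
    by have := h1 u.1 u.2; rewrite -surjective_pairing cu; apply.
  have step o : (o.+1 < sumn ds)%N ->
     (idx ds o = idx ds o.+1 -> b o.+1 = b o) /\
     (idx ds o <> idx ds o.+1 -> b o.+1 < b o).
    move=> ho; have [u [uZ cu ou eu1 eu2]] := diag_at o (ltnW ho).
    have [v [vZ cv ov ev1 ev2]] := diag_at o.+1 ho.
    have n1 : v.1 = u.1.+1 :> nat by rewrite ev1 eu1 addnS.
    have n2 : v.2 = u.2.+1 :> nat by rewrite ev2 eu2 addnS.
    have J := joined_equivalence uZ vZ cu cv (pair_neq _ _ n1).
    have := h2 u.1 v.1 u.2 v.2 n1 n2; rewrite -!surjective_pairing.
    rewrite (bE u o) // (bE v o.+1) // => /(_ uZ vZ cu cv)[j1 j2].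
    rewrite J ou ov in j1 j2.
    by split=> [/j1|/j2].
  have strip v x : (v < size ds)%N -> (x < nth 0 ds v)%N ->
      b (start ds v + x)%N = b (start ds v).
    move=> hv; elim: x => [|x IH] hx; first by rewrite addn0.
    have hx' := ltnW hx; rewrite -IH // addnS.
    apply: (step _ _).1; rewrite -addnS ?start_sumn //.
    by rewrite !idx_start.
  have drop v : (v.+1 < size ds)%N -> b (start ds v.+1) < b (start ds v).
    move=> hv; have n0 := nth_pos pds (ltnW hv); have n1 := nth_pos pds hv.
    have sv := startS ds v.
    have l1 := start_sumn n1; rewrite addn0 in l1.
    have lp : ((nth 0 ds v).-1 < nth 0 ds v)%N by lia.
    have E : start ds v.+1 = (start ds v + (nth 0 ds v).-1)%N.+1 by lia.
    rewrite -(strip v (nth 0%N ds v).-1) ?(ltnW hv) // E.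
    apply: (step _ _).2; rewrite -E // idx_start //.
    by rewrite -[start ds v.+1]addn0 idx_start //; lia.
  have lt0 v : (v < size ds)%N -> (start ds v < sumn ds)%N.
    by move=> hv; have := start_sumn (nth_pos pds hv); rewrite addn0.
  pose al' := mkseq (fun v => b (start ds v)) (size ds).
  have alE v : (v < size ds)%N -> nth 0 al' v = b (start ds v).
    exact: nth_mkseq.
  exists al'; apply/(equivalence_blkE hTd); split=> //; first by rewrite size_mkseq.
    apply/(sortedP 0) => v; rewrite size_rcons size_mkseq ltnS => hv.
    rewrite !nth_rcons size_mkseq hv alE //.
    (* The last comparison is with the 0 appended in [equivalence_form], which is positivity of the
       last circle. *)
    case: (ltngtP v.+1 (size ds)) hv => // [hv' _|e _]; last first.
      by apply/pos/lt0; rewrite -e.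
    by rewrite (alE v.+1) //; apply: drop.
  move=> u hu; have uZ : u \in Z by rewrite equivalence_zone.
  case: ifPn => od; last first.
    have := h1 u.1 u.2; rewrite -surjective_pairing => /(_ uZ).
    case E : (symb S u.1 u.2) => //; first by case: (nstar _ uZ).
    by move: od; rewrite (circle_equivalence uZ).1.
  case/andP: od => /eqP od ho.
  rewrite alE ?reshape_indexP // (in_block_entry B hu) -od.
  rewrite -[in LHS](idx_off ds (off _ u.1)) -/(b _).
  by rewrite strip ?reshape_indexP ?reshape_offsetP.
have [sl _ _ srt hB] := (equivalence_blkE hTd _ _ _ _ _).1 eB.
split.
- move=> r c rc; have hu := rc; rewrite equivalence_zone in hu.
  rewrite (hB (r, c)) //; case E : (symb S r c) => /=.
  + by case: (nstar _ rc).
  + have od := (circle_equivalence rc).1 E; rewrite od.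
    by apply: sorted_pos => //; rewrite sl reshape_indexP //; case/andP: od.
  + by case: ifP => // /(circle_equivalence rc); rewrite /= E.
- move=> r r' c c' er ec rc rc' k1 k2.
  have J := joined_equivalence rc rc' k1 k2 (pair_neq (r, c) (r', c') er).
  have d1 := (circle_equivalence rc).1 k1; have d2 := (circle_equivalence rc').1 k2.
  have hu := rc; have hv := rc'; rewrite !equivalence_zone in hu hv.
  have := hB (r, c) hu; have := hB (r', c') hv; rewrite d1 d2 /= => -> ->.
  rewrite J /=; split=> [-> //|ne].
  apply: decreasing_nth => //; last by rewrite sl reshape_indexP //; case/andP: d2.
  rewrite ltn_neqAle; apply/andP; split; first exact/eqP.
  have /in_blockP[/(row_in hTd)[/= e1 _] _] := hu.
  have /in_blockP[/(row_in hTd)[/= e2 _] _] := hv.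
  by apply: leq_idx; rewrite e1 e2 in er; lia.
(* An equivalence zone contains no star, so both conditions on stairs hold vacuously. *)
- move=> a b k st; have [//|r [c [_ _ rc]]] := star_in_zone st (x := 0%N).
  by move/(nstar _ rc).
move=> a b k t st; have [//|r [c [_ _ rc]]] := star_in_zone st (x := 0%N).
by move/(nstar _ rc).
Qed.

End Equivalence.
End Zone.
End Scheme.

(** * Matrices with a common scheme *)

Section Transfer.
Variables (C : numClosedFieldType) (m n : nat) (A : 'M[C]_(m, n)).
Variables (s : nat) (Ts : nat -> marking).
Hypothesis hT : marking_of m n (Ts 0%N).
Hypothesis hd : forall l, (l < s)%N -> derived (Ts l) A (Ts l.+1) A.
Hypothesis hs : stable (Ts s) A.
Variable S : scheme m n.
Hypothesis zonesE : forall d Z, Z \in zones S d <->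
  exists (i : rstrip (Ts d)) (j : cstrip (Ts d)), zone A s i j Z.
Hypothesis starE : forall u, symb S u.1 u.2 = Star <->
  exists d (i : rstrip (Ts d)) (j : cstrip (Ts d)) Z,
    [/\ zone A s i j Z, tied (inl i) (inr j), u \in Z &
        on_block_diagonal (Ts d) u].
Hypothesis circleE : forall u, symb S u.1 u.2 = Circle <->
  exists d (i : rstrip (Ts d)) (j : cstrip (Ts d)) Z,
    [/\ zone A s i j Z, ~~ tied (inl i) (inr j), u \in Z &
        A u.1 u.2 != 0].
Hypothesis joinedE : forall u v, joined S u v <-> u <> v /\
  [/\ symb S u.1 u.2 = Circle, symb S v.1 v.2 = Circle,
      A u.1 u.2 = A v.1 v.2 &
      exists d Z, [/\ Z \in zones S d, u \in Z & v \in Z]].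
Implicit Types (Z : {set 'I_m * 'I_n}) (u : 'I_m * 'I_n).

Lemma zones_bounded d : (s < d)%N -> zones S d = set0.
Proof.
move=> ld; apply/setP => Z; rewrite inE; apply/negP => /zonesE[i [j z]].
by have [] := candidate_eligible z.1; lia.
Qed.

Lemma zones_cover u : exists d Z, Z \in zones S d /\ u \in Z.
Proof.
have [d [i [j [Z [z uZ]]]]] := zone_cover hT hd hs u.
by exists d, Z; split=> //; apply/zonesE; exists i, j.
Qed.

Lemma zones_disjoint d d' Z Z' u :
  Z \in zones S d -> Z' \in zones S d' -> u \in Z -> u \in Z' -> d = d'.
Proof.
move=> /zonesE[i [j z]] /zonesE[i' [j' z']] uZ uZ'.
by have [] := zone_uniq hT hd hs z z' uZ uZ'.
Qed.

Lemma stairs_deeper d Z a b k t :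
  Z \in zones S d ->
  stars_under_stair S Z a b 0 k -> stars_under_stair S Z a b k.+1 t ->
  forall (i : 'I_m) (j : 'I_n),
    (a <= i <= a + k)%N -> (b + k.+1 <= j <= b + t)%N ->
    exists d' Z', [/\ (d < d')%N, Z' \in zones S d' & (i, j) \in Z'].
Proof.
move=> /zonesE[i [j z]] st st' r c.
have [//|x [y [_ _ xy xyS]]] := star_in_zone st (x := 0%N).
have [t' _] := (star_zone hT hd hs starE z xy).1 xyS.
have [_ _] := candidate_eligible z.1; rewrite /canonical_part t'.
move=> [ds [lam [sf _]]].
exact: (window_deeper hT hd hs zonesE starE z t' sf st st').
Qed.

Lemma constructed_fillable (B : 'M[C]_(m, n)) : constructed S B <-> all_fillable S B.
Proof.
exact: (constructedE (fun d => @zones_bounded d) zones_cover zones_disjoint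
  stairs_deeper).
Qed.

Lemma zone_fillableE d (i : rstrip (Ts d)) (j : cstrip (Ts d)) Z (B : 'M[C]_(m, n)) :
  zone A s i j Z -> (fillable S Z B <-> matching A B i j).
Proof.
move=> z; have [_ _] := candidate_eligible z.1.
rewrite /canonical_part /matching; case: ifPn => t [ds [a [f _]]].
  rewrite (fillable_similarity hT hd hs starE circleE z t f).
  split=> [fB ds' lam' f'|/(_ _ _ f)] //.
  by rewrite -(similarity_form_uniq f f').
(* Filling is described separately for each form [f'] of the block of [A], as [matching] asks. *)
split=> [fB ds' al' f'|/(_ _ _ f)].
  exact/(fillable_equivalence hT hd hs zonesE starE circleE joinedE z t f').
by move/(fillable_equivalence hT hd hs zonesE starE circleE joinedE z t f).
Qed.

Lemma canonical_neq0 l (i : rstrip (Ts l)) (j : cstrip (Ts l)) Z u : (l <= s)%N ->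
  canonical_part A i j Z -> in_block i j u -> Z != set0.
Proof.
move=> /(chain_marking hT hd) hTl; rewrite /canonical_part.
case: ifPn => t [ds [a [sf ->]]] hu; apply/set0Pn; last first.
  by exists u; rewrite inE.
have [_ [e1 e2] _ _ _] := (similarity_blkE hTl _ _ _ _ _).1 sf.
have /in_blockP[/(row_in hTl)[_ l1] _] := hu.
have l2 := l1; rewrite -e1 e2 in l2.
(* A diagonal place always lies under the staircase; [u] itself may be above it. *)
have [v [hv o1 o2]] := in_block_at hTl l1 l2.
by exists v; rewrite inE hv o1 o2 /=.
Qed.

(* A block of depth l that does not give a zone lies in an earlier zone; there it
   is fixed for both matrices. *)
Lemma all_matching (B : 'M[C]_(m, n)) : all_fillable S B ->
  forall l (i : rstrip (Ts l)) (j : cstrip (Ts l)),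
  eligible A s i j -> matching A B i j.
Proof.
move=> fB l; have [k] := ubnP l; elim: k l => // k IH l lk i j el.
have ls := eligible_le el; have hTl := chain_marking hT hd ls.
have [[u hu]|ne] := pselect (exists u, in_block i j u); last first.
  by apply: fixed_matching => //; left=> u hu; case: ne; exists u.
have [Z cZ] := eligible_part hT hd hs el.
have c : zone_candidate A s i j Z by split=> //; apply: canonical_neq0 hu.
have [l' [i' [j' [Z' [ll z sZ E]]]]] := candidate_in_zone c.
have [v vZ] : exists v, v \in Z by apply/set0Pn; case: c.
have vZ' := subsetP sZ v vZ.
have [ls' el' cZ'] := candidate_eligible z.1.
move: ll; rewrite leq_eqVlt => /orP[/eqP El|ll].
  subst l'; have [E1 E2] := in_block_uniq (canonical_part_block cZ' vZ')
    (canonical_part_block cZ vZ).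
  subst i' j'; apply/(zone_fillableE _ z).
  by apply: fB; apply/zonesE; exists i, j.
have mt : matching A B i' j' by apply: IH => //; lia.
have hv := canonical_part_block cZ vZ.
apply: fixed_matching => //.
  exact: (zone_fixed hT hd hs ll ls el' cZ' (matching_refl A i' j') vZ' hv).
exact: (zone_fixed hT hd hs ll ls el' cZ' mt vZ' hv).
Qed.

(** * Carrying the derivation and the scheme over to a filled matrix *)

Section Constructed.
Variable B : 'M[C]_(m, n).
Hypothesis fB : all_fillable S B.

Lemma eligible_fixed l (i : rstrip (Ts l)) (j : cstrip (Ts l)) :
  eligible A s i j -> (fixed_block A i j <-> fixed_block B i j).
Proof.
move=> el; have hTl := chain_marking hT hd (eligible_le el).
have [Z cZ] := eligible_part hT hd hs el.
exact: (matching_fixed hTl cZ (all_matching fB el)).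
Qed.

Lemma block_le_refl (x : nat * nat) : block_le x x.
Proof. by rewrite /block_le eqxx leqnn orbT. Qed.

(** Fixed blocks are compared only up to [(p, q)]. This is enough: a changed block of [B] before
    [(p, q)] would be changed for [A] too. *)
Lemma first_changed_transfer l (p : rstrip (Ts l)) (q : cstrip (Ts l)) :
  (l < s)%N -> first_changed A p q -> first_changed B p q.
Proof.
move=> ls fc; have hTl := chain_marking hT hd (ltnW ls).
have el (i : rstrip (Ts l)) (j : cstrip (Ts l)) :
    block_le (nat_of_ord i, nat_of_ord j) (nat_of_ord p, nat_of_ord q) ->
    (changes (Ts l) A i j <-> changes (Ts l) B i j).
  move=> le; rewrite (changesP hTl) (changesP hTl).
  suff -> : fixed_block A i j <-> fixed_block B i j by [].
  by apply: eligible_fixed; right; split=> //; exists p, q.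
split; first by apply/(el p q); [exact: block_le_refl|case: fc].
move=> i j ch; apply: contraT => nle.
have le := block_le_total nle.
by move/(el _ _ le): ch => /(fc.2) h; rewrite h in nle.
Qed.

(** For the converse, [A] has some first changed block at depth [l]; it passes to [B], where it is
    unique. *)
Lemma first_changed_iff l (p : rstrip (Ts l)) (q : cstrip (Ts l)) :
  (l < s)%N -> (first_changed A p q <-> first_changed B p q).
Proof.
move=> ls; split; first exact: first_changed_transfer.
have [p' [q' [fc _ _]]] := hd ls.
have fc' := first_changed_transfer ls fc.
by move=> /(first_changed_uniq fc')[<- <-].
Qed.

Lemma eligible_iff l (i : rstrip (Ts l)) (j : cstrip (Ts l)) :
  eligible A s i j <-> eligible B s i j.
Proof.
by split=> -[e|[ls [p [q [fc le]]]]]; [left|right|left|right]=> //; split=> //;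
  exists p, q; split=> //; apply/first_changed_iff.
Qed.

Lemma transfer_derivation : derivation (Ts 0%N) B s Ts (fun=> B).
Proof.
split=> //.
  move=> l ls; have hTl := chain_marking hT hd (ltnW ls).
  have [p [q [fc _ h]]] := hd ls; exists p, q.
  split; [exact: first_changed_transfer|exact: equivalent_refl|].
  have mt : matching A B p q.
    apply: all_matching => //; right; split=> //; exists p, q; split=> //.
    exact: block_le_refl.
  move: h mt; rewrite /matching; case: ifP => _ [ds [a [f ->]]] /(_ _ _ f)[b fb];
    by exists ds, b.
move=> i j; have hTs := chain_marking hT hd (leqnn s).
apply: fixed_unchanged => //; apply/eligible_fixed; first by left.
exact: unchanged_fixed.
Qed.

Lemma candidate_iff l (i : rstrip (Ts l)) (j : cstrip (Ts l)) Z :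
  zone_candidate A s i j Z <-> zone_candidate B s i j Z.
Proof.
have E : eligible A s i j -> (canonical_part A i j Z <-> canonical_part B i j Z).
  move=> el; have [Z0 cZ0] := eligible_part hT hd hs el.
  exact: (matching_canonical _ cZ0 (all_matching fB el)).
split=> -[el cZ Z0]; split=> //; try exact/eligible_iff; apply/E => //.
exact/eligible_iff.
Qed.

Lemma zone_below_iff l Z : zone_below A s Ts l Z <-> zone_below B s Ts l Z.
Proof.
elim: l Z => //= l IH Z; rewrite IH.
have E1 :
   (exists (i : rstrip (Ts l)) (j : cstrip (Ts l)), zone_candidate A s i j Z) <->
   (exists (i : rstrip (Ts l)) (j : cstrip (Ts l)), zone_candidate B s i j Z).
  by split=> -[i [j c]]; exists i, j; apply/candidate_iff.
have E2 : (exists2 Z', zone_below A s Ts l Z' & Z \subset Z') <->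
   (exists2 Z', zone_below B s Ts l Z' & Z \subset Z').
  by split=> -[Z' b sZ]; exists Z' => //; apply/IH.
by rewrite E1 E2.
Qed.

Lemma zone_iff l (i : rstrip (Ts l)) (j : cstrip (Ts l)) Z :
  zone A s i j Z <-> zone B s i j Z.
Proof.
rewrite /zone candidate_iff.
have E2 : (exists2 Z', zone_below A s Ts l Z' & Z \subset Z') <->
   (exists2 Z', zone_below B s Ts l Z' & Z \subset Z').
  by split=> -[Z' b sZ]; exists Z' => //; apply/zone_below_iff.
by rewrite E2.
Qed.

Lemma equivalence_zone_forms d (i : rstrip (Ts d)) (j : cstrip (Ts d)) Z :
  zone A s i j Z -> ~~ tied (inl i) (inr j) ->
  exists ds a b, equivalence_form ds a (blk (Ts d) A i j) /\
    equivalence_form ds b (blk (Ts d) B i j).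
Proof.
move=> z t; have [_ el] := candidate_eligible z.1.
have := all_matching fB el; rewrite /canonical_part /matching (negPf t).
move=> mt [ds [a [f _]]]; have [b fb] := mt _ _ f.
by exists ds, a, b.
Qed.

(** Stars are given by the zones and divisions; circles and lines depend in addition on the sizes in
    (1), which [A] and [B] share on every equivalence zone. *)
Lemma transfer_scheme : scheme_of (Ts 0%N) B S.
Proof.
exists s, Ts; split; first exact: transfer_derivation.
split.
- move=> d Z; rewrite zonesE.
  by split=> -[i [j z]]; exists i, j; apply/zone_iff.
- move=> u; rewrite starE; split=> -[d [i [j [Z [z t uZ od]]]]];
    by exists d, i, j, Z; split=> //; apply/zone_iff.
- move=> u; rewrite circleE.
  have E d (i : rstrip (Ts d)) (j : cstrip (Ts d)) Z : zone A s i j Z ->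
      ~~ tied (inl i) (inr j) -> u \in Z -> (A u.1 u.2 != 0) = (B u.1 u.2 != 0).
    move=> z t uZ; have [ds [a [b [fA fb]]]] := equivalence_zone_forms z t.
    have [ls _ cZ] := candidate_eligible z.1.
    have hTl := chain_marking hT hd ls.
    have hu := canonical_part_block cZ uZ.
    by rewrite (equivalence_neq0 hTl fA hu) (equivalence_neq0 hTl fb hu).
  split=> -[d [i [j [Z [z t uZ nz]]]]]; exists d, i, j, Z; split=> //.
  + exact/zone_iff.
  + by rewrite -(E d i j Z).
  + exact/zone_iff.
  by move/zone_iff: z => z; rewrite (E d i j Z).
move=> u v; rewrite joinedE.
have E : symb S u.1 u.2 = Circle -> symb S v.1 v.2 = Circle ->
   (exists d Z, [/\ Z \in zones S d, u \in Z & v \in Z]) ->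
   (A u.1 u.2 = A v.1 v.2 <-> B u.1 u.2 = B v.1 v.2).
  move=> cu cv [d [Z [/zonesE[i [j z]] uZ vZ]]].
  have [t nu] := (circle_zone hT hd hs circleE z uZ).1 cu.
  have [_ nv] := (circle_zone hT hd hs circleE z vZ).1 cv.
  have [ds [a [b [fA fb]]]] := equivalence_zone_forms z t.
  have [ls _ cZ] := candidate_eligible z.1.
  have hTl := chain_marking hT hd ls.
  have hu := canonical_part_block cZ uZ; have hv := canonical_part_block cZ vZ.
  rewrite (equivalence_neq0 hTl fA hu) in nu.
  rewrite (equivalence_neq0 hTl fA hv) in nv.
  by rewrite (equivalence_eq hTl fA hu hv nu nv) (equivalence_eq hTl fb hu hv nu nv).
by split=> -[ne [cu cv e ex]]; do 2 split=> //; apply/(E cu cv ex).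
Qed.

End Constructed.

Lemma scheme_fillable : all_fillable S A.
Proof.
move=> d Z /zonesE[i [j z]]; apply/(zone_fillableE A z).
exact: matching_refl.
Qed.

End Transfer.

Theorem theorem2p3 (R : realType) (m n : nat) (T : marking)
    (hT : marking_of m n T) (S : scheme m n)
    (hS : exists A0 : 'M[R[i]]_(m, n), canonical T A0 /\ scheme_of T A0 S) :
  (forall A : 'M[R[i]]_(m, n),
     (canonical T A /\ scheme_of T A S) <-> constructed S A) /\
  (forall (d : nat) (Z : {set 'I_m * 'I_n}) (alpha beta k t : nat),
     Z \in zones S d ->
     stars_under_stair S Z alpha beta 0 k ->
     stars_under_stair S Z alpha beta k.+1 t ->
     forall (i : 'I_m) (j : 'I_n),
       (alpha <= i <= alpha + k)%N -> (beta + k.+1 <= j <= beta + t)%N ->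
       exists d' Z', [/\ (d < d')%N, Z' \in zones S d' & (i, j) \in Z']).
Proof.
have [A0 [_ [s0 [Ts0 [[T0 _ hd0 hs0] [z0 st0 c0 j0]]]]]] := hS.
have hT0 : marking_of m n (Ts0 0%N) by rewrite T0.
split=> [A|]; last exact: (stairs_deeper hT0 hd0 hs0 z0 st0).
(* A matrix with scheme [S] is tested against its own derivation, which need not be the given one of
   [A0]; only the converse transports the derivation of [A0]. *)
split=> [[_ [s [Ts [[E _ hd hs] [z st c j]]]]]|].
  have hT' : marking_of m n (Ts 0%N) by rewrite E.
  apply/(constructed_fillable hT' hd hs z st).
  exact: (scheme_fillable hT' hd hs z st c j).
move/(constructed_fillable hT0 hd0 hs0 z0 st0) => fA.
have sch := transfer_scheme hT0 hd0 hs0 z0 st0 c0 j0 fA.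
rewrite T0 in sch; split=> //.
by have [s [Ts [D _]]] := sch; exists s, Ts, (fun=> A).
Qed.
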